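(* Let $R=k[x_1,\dots,x_m]$ be a standard graded polynomial ring over a field $k$, let $I$ be a homogeneous ideal of $R$, and let $J\subseteq R$ be an ideal with $\dim R/J\le1$. For $n\ge1$ let $I^{(n)}=I^n:\langle J\rangle=\bigcup_{r\ge0}(I^n:J^r)$. Then there exists a constant $e$ such that for all $n>0$, $$\operatorname{reg}(I^{(n)})\le d(I)n+e.$$
   Context: $d(I)$ denotes the maximum degree of a minimal homogeneous generator of $I$. For a finitely generated graded $R$-module $E$, with $\mathfrak m=(x_1,\dots,x_m)$, $a_i(E)=\max\{r: H^i_{\mathfrak m}(E)_r\neq0\}$ ($-\infty$ if the module vanishes) and $\operatorname{reg}(E)=\max_i\{a_i(E)+i\}$; the regularity of a homogeneous ideal is its regularity as a graded module. *)

(* Defs.v *)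
From HB Require Import structures.
From mathcomp Require Import all_boot all_order all_algebra.
From mathcomp Require Export mpoly.
Set Implicit Arguments. Unset Strict Implicit. Unset Printing Implicit Defensive.
Import Order.TTheory GRing.Theory Num.Theory.
Local Open Scope ring_scope.

Section CA.
Variables (k : fieldType) (m : nat).
Local Notation R := {mpoly k[m]}.

Definition is_ideal (I : R -> Prop) : Prop :=
  I 0 /\ (forall f g, I f -> I g -> I (f + g)) /\ (forall r f, I f -> I (r * f)).

Definition in_span (S : R -> Prop) (f : R) : Prop :=
  exists s : seq (R * R), (forall p, p \in s -> S p.2) /\
    f = \sum_(p <- s) p.1 * p.2.

Definition is_homogeneous (g : R) : Prop := exists d : nat, g \is d.-homog.

Definition homogeneous_ideal (I : R -> Prop) : Prop :=
  forall f, I f -> in_span (fun g => I g /\ is_homogeneous g) f.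

Definition ideal_pow (I : R -> Prop) (n : nat) : R -> Prop :=
  in_span (fun g => exists t : n.-tuple R,
                     (forall x, x \in t -> I x) /\ g = \prod_(x <- t) x).

Definition colon (I J : R -> Prop) : R -> Prop :=
  fun f => forall g, J g -> I (f * g).

Definition symb_pow (I J : R -> Prop) (n : nat) : R -> Prop :=
  fun f => exists r : nat, colon (ideal_pow I n) (ideal_pow J r) f.

Definition prime_ideal (P : R -> Prop) : Prop :=
  is_ideal P /\ ~ P 1 /\ (forall f g, P (f * g) -> P f \/ P g).

Definition strict_incl (A B : R -> Prop) : Prop :=
  (forall f, A f -> B f) /\ exists f, B f /\ ~ A f.

Definition dim_quot_le1 (J : R -> Prop) : Prop :=
  ~ exists P0 P1 P2 : R -> Prop,
      [/\ prime_ideal P0, prime_ideal P1, prime_ideal P2,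
          (forall f, J f -> P0 f) & strict_incl P0 P1 /\ strict_incl P1 P2].

(* d(I) = D : D is the maximal degree of the elements of a minimal homogeneous
   generating system s of I (for s = [::], i.e. I = 0, D = 0). *)
Definition max_gen_degree (I : R -> Prop) (D : nat) : Prop :=
  exists s : seq R,
    [/\ (forall g, g \in s -> I g /\ is_homogeneous g),
        (forall f, I f <-> in_span (fun g => g \in s) f),
        (forall g, g \in s ->
           ~ (forall f, I f -> in_span (fun h => h \in rem g s) f))
      & D = (\max_(g <- s) (msize g).-1)%N].

(* ---- local cohomology H^i_m(E)_r of a graded ideal E, via the Cech complex
   on x_1..x_m.  Since E is a submodule of the domain R, every localization
   E_{x_F} embeds into Frac R, so an element of (E_{x_F})_r is f / x_F^a with
   f in E homogeneous of degree r + a|F|, and equalities are checked by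
   cross-multiplication in R. ---- *)

Definition homog_int (d : int) (p : R) : Prop :=
  p = 0 \/ exists n : nat, d = n%:Z /\ p \is n.-homog.

Definition xpow (F : {set 'I_m}) (a : nat) : R := \prod_(i in F) 'X_i ^+ a.

Definition csign (j : 'I_m) (G : {set 'I_m}) : R :=
  (-1) ^+ #|[set i in G | (i < j)%N]|.

(* c = (f_F / x_F^a)_{|F| = i} is a degree r cocycle of C^i(E) *)
Definition cech_cocycle (E : R -> Prop) (i : nat) (r : int) (a : nat)
  (f : {set 'I_m} -> R) : Prop :=
  (forall F : {set 'I_m}, #|F| = i -> E (f F) /\ homog_int (r + (a * i)%N%:Z) (f F)) /\
  (forall G : {set 'I_m}, #|G| = i.+1 ->
     \sum_(j in G) csign j G * f (G :\ j) * 'X_j ^+ a = 0).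

(* c is a coboundary (C^{-1} = 0) *)
Definition cech_coboundary (E : R -> Prop) (i : nat) (r : int) (a : nat)
  (f : {set 'I_m} -> R) : Prop :=
  if i is i'.+1 then
    exists (a' : nat) (g : {set 'I_m} -> R),
      (forall H : {set 'I_m}, #|H| = i' -> E (g H) /\ homog_int (r + (a' * i')%N%:Z) (g H)) /\
      (forall F : {set 'I_m}, #|F| = i ->
         f F * xpow F a' = (\sum_(j in F) csign j F * g (F :\ j) * 'X_j ^+ a') * xpow F a)
  else forall F : {set 'I_m}, #|F| = 0%N -> f F = 0.

Definition lc_nonzero (E : R -> Prop) (i : nat) (r : int) : Prop :=
  exists (a : nat) (f : {set 'I_m} -> R),
    cech_cocycle E i r a f /\ ~ cech_coboundary E i r a f.

(* reg(E) <= b, where reg(E) = max_i (a_i(E) + i),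
   a_i(E) = max { r | H^i_m(E)_r <> 0 } *)
Definition reg_le (E : R -> Prop) (b : int) : Prop :=
  forall (i : nat) (r : int), lc_nonzero E i r -> r + i%:Z <= b.

End CA.

(* Main.v *)
(* The key point is that [reg (I^n) <= d(I) n + e], proved with monomials of the
   Rees presentation [k[x_1..x_m, y_1..y_p] -> R[I t], y_j |-> s_j t], where the
   [s_j] generate [I].  The leading monomials of its kernel form an up-closed set,
   so by Dickson's lemma there is an [N] such that multiplication by [x_j] preserves
   standard monomials whose [x_j]-exponent is at least [N].  In y-degree [n] and
   total degree above [d(I) n + m N] every Laurent monomial has such an [x_j], and
   the Koszul complexes on the [x_i ^ a] computing local cohomology can be contracted
   along it, one leading monomial at a time.

   For the saturation [S] of [E = I^n]: in cohomological degree at least 2, cocycles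
   of [S] are moved into [E].  If [A] is the annihilator modulo [E] of the components
   of a cocycle, [dim R/A <= 1] yields relations [x_l^b x_p^K = c x_p^(K+a)] modulo
   [A], which make the cocycle [x_p]-torsion modulo [E] up to a coboundary; doing
   this for every [p], then raising the level of the Koszul complex, kills it.  In
   degrees 0 and 1, a cocycle of [S] is a coboundary in [R = I^0], and its primitive
   lies in [S] because [S] is saturated (if [J] is not inside the irrelevant ideal,
   homogeneous elements of [S] already lie in [E]). *)
Require Import Defs.
From HB Require Import structures.
From mathcomp Require Import all_boot all_order all_algebra.
From mathcomp Require Import mpoly.
From mathcomp Require Import zify ring.
From mathcomp Require boolp classical_sets.
Import Order.TTheory GRing.Theory Num.Theory.
Local Open Scope ring_scope.
Set Implicit Arguments. Unset Strict Implicit. Unset Printing Implicit Defensive.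

(** * Dickson's lemma *)

Lemma all2_map_minn (N1 N2 : nat) (v : seq nat) : (N1 <= N2)%N ->
  all2 leq (map (minn N1) v) (map (minn N2) v).
Proof. by move=> h; elim: v => //= x v ->; rewrite andbT; lia. Qed.

(** Finite generation is phrased as truncation: members of [U] stay in [U] when all entries are cut
    at [N]. Induction on the length, applied to the tails under each fixed head and to the tails
    admitting some head. *)
Lemma dickson_seq (p : nat) (U : seq nat -> Prop) :
  (forall v w, size v = p -> all2 leq v w -> U v -> U w) ->
  exists N, forall v, size v = p -> U v -> U (map (minn N) v).
Proof.
elim: p U => [|p IH] U Uup; first by exists 0%N => -[].
have sizeM N v : size v = p -> size (map (minn N) v) = p by rewrite size_map.
have [Nc Nc_spec] : exists Nc : nat -> nat, forall c v, size v = p ->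
    U (c :: v) -> U (c :: map (minn (Nc c)) v).
  suff /boolp.choice[g gP] : forall c, exists N, forall v, size v = p ->
      U (c :: v) -> U (c :: map (minn N) v) by exists g.
  move=> c.
  apply: (IH (fun v => U (c :: v))) => v w sv vw; apply: Uup => /=.
    by rewrite sv.
  by rewrite leqnn.
have [Ni Ni_spec] : exists N, forall v, size v = p ->
    (exists c, U (c :: v)) -> exists c, U (c :: map (minn N) v).
  apply: (IH (fun v => exists c, U (c :: v))) => v w sv vw [c Uc].
  exists c; apply: Uup Uc; first by rewrite /= sv.
  by rewrite /= leqnn.
(* Only finitely many tails have entries at most [Ni], so one head [C] serves all those that admit a
   head. *)
have [C C_spec] : exists C, forall t : p.-tuple 'I_Ni.+1,
    (exists c, U (c :: map val (tval t))) -> U (C :: map val (tval t)).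
  have [f f_spec] : exists f : p.-tuple 'I_Ni.+1 -> nat, forall t : p.-tuple _,
      (exists c, U (c :: map val (tval t))) -> U (f t :: map val (tval t)).
    suff /boolp.choice[g gP] : forall t : p.-tuple 'I_Ni.+1, exists d,
        (exists c, U (c :: map val (tval t))) -> U (d :: map val (tval t)) by exists g.
    move=> t.
    have [[c Uc]|nU] := boolp.EM (exists c, U (c :: map val (tval t))).
      by exists c.
    by exists 0%N.
  exists (\max_t f t) => t /f_spec; apply: Uup.
    by rewrite /= size_map size_tuple.
  rewrite /= (leq_bigmax (F := f)) /=.
  by elim: (map _ _) => //= x s ->; rewrite leqnn.
pose M := (\max_(c < C) Nc c)%N.
exists (maxn C (maxn Ni M)) => -[|c v] //= [sv] Uc.
(* A head at least [C] is lowered to [C] over the tail cut at [Ni]; the finitely many smaller heads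
   are kept and use their own bounds [Nc c]. *)
have [leCc | ltcC] := leqP C c.
- have sz : size (map (fun x => inord (minn Ni x) : 'I_Ni.+1) v) == p.
    by rewrite size_map sv.
  have mE : map val (tval (Tuple sz)) = map (minn Ni) v.
    rewrite /= -map_comp; apply: eq_map => x /=.
    by rewrite inordK // ltnS geq_minl.
  have Uex : exists d, U (d :: map val (tval (Tuple sz))).
    by rewrite mE; apply: Ni_spec => //; exists c.
  move: (C_spec _ Uex); rewrite mE; apply: Uup; first by rewrite /= sizeM.
  by rewrite /= all2_map_minn ?andbT ?leq_min ?leq_max ?leqnn ?orbT.
- have := Nc_spec _ _ sv Uc; apply: Uup; first by rewrite /= sizeM.
  have le : (Nc c <= M)%N.
    exact: (leq_bigmax (F := fun c : 'I_C => Nc c) (Ordinal ltcC)).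
  rewrite /= all2_map_minn ?andbT ?leq_max ?le ?orbT //.
  by rewrite leq_min leqnn leq_max (ltnW ltcC).
Qed.

(** Once the exponent [w i] has reached [N], increasing it does not change the truncation at [N], so
    membership cannot be gained that way. *)
Lemma dickson_mnm (q : nat) (U : 'X_{1..q} -> Prop) :
  (forall w v, U w -> U (w + v)%MM) ->
  exists N, forall (w : 'X_{1..q}) (i : 'I_q) (a : nat),
    (N <= w i)%N -> U (w + U_(i) *+ a)%MM -> U w.
Proof.
move=> Uup.
have Uup' (v w : 'X_{1..q}) : (v <= w)%MM -> U v -> U w.
  by move=> /submK <- ?; rewrite addmC; apply: Uup.
pose mk (s : seq nat) : 'X_{1..q} := [multinom nth 0%N s i | i < q].
have mkK (w : 'X_{1..q}) : mk w = w.
  by apply/mnmP => i; rewrite mnmE (mnm_nth 0%N).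
have [|N N_spec] := @dickson_seq q (fun s => U (mk s)).
  move=> v w sv vw; apply: Uup'; apply/mnm_lepP => i; rewrite !mnmE.
  move: (nat_of_ord i); elim: v w {sv} vw => [|x v IH] [|y w] //=.
  by case/andP => xy vw [|j] //=; apply: IH.
exists N => w i a Nw Uw.
have := N_spec (w + U_(i) *+ a)%MM; rewrite mkK size_tuple => /(_ erefl Uw).
apply: Uup'; apply/mnm_lepP => j; rewrite mnmE.
rewrite (nth_map 0%N) ?size_tuple // -mnm_nth mnmDE mulmnE mnm1E.
by have [<-|] := eqVneq i j; rewrite /= ?mul0n ?addn0; lia.
Qed.

(** * Koszul complexes on powers of the variables *)

Section Koszul.
Variables (k : fieldType) (m : nat).
Local Notation R := {mpoly k[m]}.
Implicit Types (f g : {set 'I_m} -> R) (F G H : {set 'I_m}) (y : 'I_m -> R).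

(** With [y j = 'X_j ^+ a] this is the Cech differential on fractions over [x_F^a], written on
    numerators. With [y = 1] it acts on the coefficients of a single multidegree. *)
Definition koszul_d y f G : R := \sum_(j in G) csign k j G * f (G :\ j) * y j.

Definition contraction (p : 'I_m) f H : R :=
  if p \in H then 0 else csign k p (p |: H) * f (p |: H).

Lemma csign_sqr (j : 'I_m) G : csign k j G * csign k j G = 1.
Proof. by rewrite /csign -signr_odd -signr_addb addbb. Qed.

Lemma csignD1 (j l : 'I_m) G : l \in G ->
  csign k j G = csign k j (G :\ l) * (-1) ^+ (l < j)%N.
Proof.
move=> lG; rewrite /csign -exprD; congr (_ ^+ _).
rewrite (cardsD1 l) inE lG /= addnC; congr (_ + _)%N; apply: eq_card => i.
by rewrite !inE andbA.
Qed.

Lemma csign_swap (j l : 'I_m) G : j != l -> j \in G -> l \in G ->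
  csign k l G * csign k j (G :\ l) = - (csign k j G * csign k l (G :\ j)).
Proof.
move=> jl jG lG; rewrite (csignD1 l jG) (csignD1 j lG).
by case: ltngtP jl => [||/val_inj->]; rewrite ?eqxx //= expr0 expr1 => _ _; ring.
Qed.

(** The homotopy identity d h + h d = y_p for h = [contraction p], with the term h d written out. *)
Lemma koszul_d_contraction y p f F :
  koszul_d y (contraction p f) F =
  y p * f F - (if p \in F then 0 else csign k p (p |: F) * koszul_d y f (p |: F)).
Proof.
have [pF|pF] := boolP (p \in F).
  rewrite /koszul_d (bigD1 p) //= /contraction !inE eqxx /= setD1K // big1.
    by rewrite mulrA csign_sqr; ring.
  by move=> l /andP[lF lp]; rewrite !inE eq_sym lp pF /=; ring.
rewrite /koszul_d big_setU1 //= setU1K // mulrDr.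
have -> : csign k p (p |: F) * (csign k p (p |: F) * f F * y p) = y p * f F.
  by rewrite !mulrA csign_sqr; ring.
rewrite opprD addrA subrr add0r mulr_sumr -sumrN; apply: eq_bigr => l lF.
have lp : p != l by apply: contraNneq pF => ->.
rewrite /contraction !inE lp (negPf pF) /=.
have -> : p |: F :\ l = (p |: F) :\ l.
  by apply/setP => x; rewrite !inE; case: eqVneq => // ->; rewrite lp.
have := csign_swap lp (setU11 p F) (setU1r p lF); rewrite setU1K //.
move: (csign_sqr p (p |: F)) (csign_sqr p ((p |: F) :\ l)).
move: (csign k p (p |: F)) (csign k p ((p |: F) :\ l)) => A C AA CC e.
have -> : csign k l F = - (A * csign k l (p |: F) * C).
  by rewrite -[LHS]mul1r -AA -!mulrA [A * csign k l F]mulrC; ring: e.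
transitivity (- (A * csign k l (p |: F) * (C * C) * f ((p |: F) :\ l) * y l)).
  by ring.
by rewrite CC; ring.
Qed.

Lemma koszul_dd y f G : koszul_d y (koszul_d y f) G = 0.
Proof.
pose a (l j : 'I_m) :=
  csign k l G * (csign k j (G :\ l) * f (G :\ l :\ j) * y j) * y l.
have -> : koszul_d y (koszul_d y f) G =
    \sum_(lj : 'I_m * 'I_m | [&& lj.1 \in G, lj.2 \in G & lj.2 != lj.1])
      a lj.1 lj.2.
  rewrite /koszul_d.
  under eq_bigr => l lG do rewrite mulr_sumr mulr_suml.
  rewrite pair_big_dep /=; apply: eq_bigl => -[l j] /=.
  by rewrite !inE; case: (l \in G) => //=; rewrite andbC.
(* Exchanging the two removed indices pairs the terms with l < j and those with l > j, with opposite
   signs. *)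
rewrite (bigID (fun lj : 'I_m * 'I_m => lj.1 < lj.2)%N) /=.
rewrite [X in _ + X](reindex_inj (h := fun lj => (lj.2, lj.1))) /=; last first.
  by move=> [? ?] [? ?] [-> ->].
rewrite [X in _ + X](eq_big (fun lj : 'I_m * 'I_m =>
  [&& lj.1 \in G, lj.2 \in G & lj.2 != lj.1] && (lj.1 < lj.2)%N)
  (fun lj => - a lj.1 lj.2)) /=.
- by rewrite sumrN subrr.
- move=> [l j] /=; rewrite -[l == j]val_eqE -[j == l]val_eqE /=.
  by case: (l \in G) (j \in G) => [] [] //=; case: ltngtP.
- move=> [l j] /= /andP[/and3P[jG lG lj] _]; rewrite /a.
  have -> : G :\ j :\ l = G :\ l :\ j by rewrite !setDDl setUC.
  have jl : j != l by rewrite eq_sym.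
  have e := csign_swap jl jG lG.
  have -> : forall A B C D E : R,
    A * (B * C * D) * E = A * B * (C * D * E) by move=> *; ring.
  have -> : forall A B C D E : R,
    A * (B * C * D) * E = A * B * (C * E * D) by move=> *; ring.
  by rewrite e; ring.
Qed.

End Koszul.

(** * Ideals, powers and primes *)

Section Ideals.
Variables (k : fieldType) (m : nat).
Local Notation R := {mpoly k[m]}.
Implicit Types (A E I J P T : R -> Prop) (f g : R).

Lemma is_ideal0 E : is_ideal E -> E 0. Proof. by case. Qed.

Lemma is_idealD E f g : is_ideal E -> E f -> E g -> E (f + g).
Proof. by move=> [_ [h _]]; exact: h. Qed.

Lemma is_idealM E f g : is_ideal E -> E g -> E (f * g).
Proof. by move=> [_ [_ h]]; exact: h. Qed.

Lemma is_idealMr E f g : is_ideal E -> E f -> E (f * g).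
Proof. by move=> iE Ef; rewrite mulrC; exact: is_idealM. Qed.

Lemma is_idealN E f : is_ideal E -> E f -> E (- f).
Proof. by move=> iE Ef; rewrite -mulN1r; exact: is_idealM. Qed.

Lemma is_idealB E f g : is_ideal E -> E f -> E g -> E (f - g).
Proof. by move=> iE Ef Eg; apply: is_idealD => //; exact: is_idealN. Qed.

Lemma is_idealZ E (c : k) f : is_ideal E -> E f -> E (c *: f).
Proof. by move=> iE Ef; rewrite -mul_mpolyC; exact: is_idealM. Qed.

Lemma ideal_sum E (X : Type) (s : seq X) (Q : pred X) (F : X -> R) :
  is_ideal E -> (forall i, Q i -> E (F i)) -> E (\sum_(i <- s | Q i) F i).
Proof.
by move=> iE h; elim/big_ind: _ => //; [exact: is_ideal0 | move=> *; exact: is_idealD].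
Qed.

Lemma ideal_sum_seq E (X : eqType) (s : seq X) (F : X -> R) :
  is_ideal E -> (forall i, i \in s -> E (F i)) -> E (\sum_(i <- s) F i).
Proof. by move=> iE h; rewrite big_seq; apply: ideal_sum. Qed.

Lemma in_span_ideal (S : R -> Prop) : is_ideal (in_span S).
Proof.
split; first by exists [::]; split => //; rewrite big_nil.
split=> [f g [s [sS ->]] [t [tS ->]] | r f [s [sS ->]]].
  exists (s ++ t); split; last by rewrite big_cat.
  by move=> p; rewrite mem_cat => /orP[]; [exact: sS | exact: tS].
exists [seq (r * p.1, p.2) | p <- s]; split.
  by move=> _ /mapP[p ps ->]; exact: (sS p).
by rewrite big_map mulr_sumr; apply: eq_bigr => p _; exact: mulrA.
Qed.

Lemma in_span_sub (S : R -> Prop) f : S f -> in_span S f.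
Proof.
move=> Sf; exists [:: (1, f)]; split; last by rewrite big_seq1 mul1r.
by move=> p; rewrite inE => /eqP->.
Qed.

Lemma in_span_min (S : R -> Prop) E f :
  is_ideal E -> (forall g, S g -> E g) -> in_span S f -> E f.
Proof.
move=> iE SE [s [sS ->]]; apply: ideal_sum_seq => // p ps.
by apply: is_idealM => //; apply/SE/sS.
Qed.

Lemma ideal_pow_ideal I n : is_ideal (ideal_pow I n).
Proof. exact: in_span_ideal. Qed.

Lemma ideal_pow0 I f : ideal_pow I 0 f.
Proof.
rewrite -[f]mulr1; apply: (is_idealM _ (ideal_pow_ideal I 0)).
by apply: in_span_sub; exists [tuple]; split => //; rewrite big_nil.
Qed.

Lemma ideal_pow1 I f : I f -> ideal_pow I 1 f.
Proof.
move=> If; apply: in_span_sub; exists [tuple f]; split; last by rewrite big_seq1.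
by move=> x; rewrite inE => /eqP->.
Qed.

Lemma ideal_powM I a b f g :
  ideal_pow I a f -> ideal_pow I b g -> ideal_pow I (a + b) (f * g).
Proof.
move=> If Ig; have iab := ideal_pow_ideal I (a + b).
apply: (@in_span_min _ (fun f => ideal_pow I (a + b) (f * g)) f _ _ If).
  split; first by rewrite mul0r; exact: is_ideal0.
  split=> [x y hx hy | r x hx]; first by rewrite mulrDl; exact: is_idealD.
  by rewrite -mulrA; exact: is_idealM.
move=> _ [t [tI ->]].
apply: (@in_span_min _ (fun g => ideal_pow I (a + b) (_ * g)) g _ _ Ig).
  split; first by rewrite mulr0; exact: is_ideal0.
  split=> [x y hx hy | r x hx]; first by rewrite mulrDr; exact: is_idealD.
  by rewrite mulrCA; exact: is_idealM.
move=> _ [u [uI ->]]; apply: in_span_sub; exists (cat_tuple t u).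
split; last by rewrite big_cat.
by move=> x; rewrite mem_cat => /orP[]; [exact: tI | exact: uI].
Qed.

Lemma ideal_powX I n f : I f -> ideal_pow I n (f ^+ n).
Proof.
move=> If; elim: n => [|n IH]; first exact: ideal_pow0.
by rewrite exprS -[n.+1]add1n; apply: ideal_powM => //; exact: ideal_pow1.
Qed.

Lemma ideal_pow_min I E n : is_ideal E ->
  (forall t : n.-tuple R, (forall x, x \in t -> I x) -> E (\prod_(x <- t) x)) ->
  forall f, ideal_pow I n f -> E f.
Proof. by move=> iE h f; apply: in_span_min => // _ [t [tI ->]]; exact: h. Qed.

Lemma ideal_pow_sub I a b f : ideal_pow I (a + b) f -> ideal_pow I a f.
Proof.
have ia := ideal_pow_ideal I a.
apply: ideal_pow_min => // t tI.
have -> : \prod_(x <- t) x =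
    \prod_(x <- take a t) x * \prod_(x <- drop a t) x.
  by rewrite -big_cat cat_take_drop.
apply: is_idealMr => //; apply: in_span_sub.
have sz : size (take a t) == a by rewrite size_takel // size_tuple leq_addr.
by exists (Tuple sz); split => // x /mem_take; exact: tI.
Qed.

Lemma prime_ideal_pow P J r : prime_ideal P ->
  (forall f, ideal_pow J r f -> P f) -> forall f, J f -> P f.
Proof.
move=> [iP [P1 PM]] h f Jf; have {h} := h _ (ideal_powX r Jf).
elim: r => [|r IH]; first by rewrite expr0.
by rewrite exprS => /PM[].
Qed.

(** An ideal maximal among those containing [A] and avoiding the multiplicative set [T] is prime. *)
Lemma prime_ideal_disjoint A T : is_ideal A -> T 1 ->
  (forall x y, T x -> T y -> T (x * y)) -> (forall x, A x -> ~ T x) ->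
  exists P, [/\ prime_ideal P, forall x, A x -> P x & forall x, P x -> ~ T x].
Proof.
move=> iA T1 TM AT.
pose good X := [/\ is_ideal X, forall x, A x -> X x & forall x, X x -> ~ T x].
have [F Fgood Ftot | M [Mgood Mmax]] :=
  @classical_sets.Zorn_bigcup R (fun X => (forall x, ~ X x) \/ good X).
  have [[X FX [x Xx]] | noX] := boolp.EM (exists2 X, F X & exists x, X x);
    last by left=> x [X FX Xx]; apply: noX; exists X => //; exists x.
  have gX Y y : F Y -> Y y -> good Y.
    by move=> FY Yy; case: (Fgood _ FY) => // /(_ y).
  right; split.
  - split; first by exists X => //; apply: is_ideal0; case: (gX _ _ FX Xx).
    split=> [f g [Y FY Yf] [Z FZ Zg] | r f [Y FY Yf]].
      have [YZ|ZY] := Ftot _ _ FY FZ.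
        by exists Z => //; apply: is_idealD => //; [case: (gX _ _ FZ Zg) | exact: YZ].
      by exists Y => //; apply: is_idealD => //; [case: (gX _ _ FY Yf) | exact: ZY].
    by exists Y => //; apply: is_idealM => //; case: (gX _ _ FY Yf).
  - by move=> x0 Ax0; exists X => //; case: (gX _ _ FX Xx) => _ + _; apply.
  - by move=> x0 [Y FY Yx0]; case: (gX _ _ FY Yx0) => _ _; apply.
case: Mgood => [M0 | [iM AM MT]].
  case: (Mmax A); last by right.
  by split=> [x /M0 // | /(_ 0 (is_ideal0 iA))/M0].
exists M; split => //; split => //; split; first by move=> /MT.
have key f : ~ M f -> exists2 u, M u & exists c, T (u + c * f).
  move=> Mf; apply: boolp.contrapT => hT.
  pose B x := exists2 u, M u & exists c, x = u + c * f.
  apply: (Mmax B).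
    split=> [x Mx | /(_ f) BM]; first by exists x => //; exists 0; rewrite mul0r addr0.
    by apply/Mf/BM; exists 0; [exact: is_ideal0 | exists 1; rewrite mul1r add0r].
  right; split.
  - split; first by exists 0; [exact: is_ideal0 | exists 0; rewrite mul0r addr0].
    split=> [x y [u Mu [c ->]] [v Mv [d ->]] | r x [u Mu [c ->]]].
      by exists (u + v); [exact: is_idealD | exists (c + d); ring].
    by exists (r * u); [exact: is_idealM | exists (r * c); ring].
  - by move=> x /AM Mx; exists x => //; exists 0; rewrite mul0r addr0.
  - by move=> x [u Mu [c ->]] Tx; apply: hT; exists u => //; exists c.
move=> f g Mfg; apply: boolp.contrapT => /boolp.not_orP[Mf Mg].
have [u Mu [c Tc]] := key _ Mf; have [v Mv [d Td]] := key _ Mg.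
apply: (MT _ _ (TM _ _ Tc Td)).
have -> : (u + c * f) * (v + d * g) = u * (v + d * g) + c * f * v + c * d * (f * g).
  by ring.
apply: is_idealD => //; last exact: is_idealM.
by apply: is_idealD => //; [exact: is_idealMr | exact: is_idealM].
Qed.

Local Notation proj d := (pihomog mdeg d).

Definition graded_ideal E := is_ideal E /\ forall d f, E f -> E (proj d f).

Lemma projM e d f g : g \is e.-homog -> proj (d + e) (f * g) = proj d f * g.
Proof.
move=> ge; rewrite {1}[f]mpolyE mulr_suml raddf_sum /= pihomogE mulr_suml.
rewrite [RHS]big_mkcond /=; apply: eq_bigr => w _.
rewrite -scalerAl linearZ /=.
have hw : 'X_[w] * g \is (mdeg w + e).-homog by rewrite dhomogM ?dhomogX.
have [<-|nwd] := eqVneq (mdeg w) d; first by rewrite pihomog_dE // scalerAl.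
by rewrite (pihomog_ne0 _ hw) ?scaler0 // eqn_add2r.
Qed.

Lemma proj0 f : proj 0 f = (f@_0)%:MP.
Proof.
apply/mpolyP => w; rewrite pihomogE mcoeffC raddf_sum /=.
under eq_bigr => v hv do rewrite mcoeffZ mcoeffX.
have [->|nw] := eqVneq w 0%MM.
  rewrite mulr1; have [h|h] := boolP (0%MM \in msupp f).
    rewrite big_mkcond (bigD1_seq 0%MM) ?msupp_uniq //= mdeg0 !eqxx mulr1.
    by rewrite big1 ?addr0 // => v /negPf v0; rewrite mdeg_eq0 v0.
  rewrite (memN_msupp_eq0 h) big1_seq // => v /andP[hv vf].
  by move: hv; rewrite mdeg_eq0 => /eqP v0; rewrite v0 (negPf h) in vf.
rewrite mulr0 big1 // => v; rewrite mdeg_eq0 => /eqP->.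
by rewrite eq_sym (negPf nw) mulr0.
Qed.

Lemma homogXn (i : 'I_m) n : ('X_i ^+ n : R) \is n.-homog.
Proof. by rewrite mpolyXn dhomogX /= mdegMn mdeg1 mul1n. Qed.

(* If no relation held, then [v = 'X_l] would avoid [A1 := (A : u^oo) + (u)],
   [u = 'X_p], even after localizing at the irrelevant ideal [mm]; a prime
   [P1] over [A1] with [v] outside and a prime [P0] under [P1] with [u] outside
   would give a chain [P0 < P1 < mm] over [A]. *)
Lemma dim_le1_relation A (p l : 'I_m) : graded_ideal A -> dim_quot_le1 A ->
  exists K N (c : R), c \is N.-homog /\
    A ('X_l ^+ N.+1 * 'X_p ^+ K - c * 'X_p ^+ K.+1).
Proof.
move=> [iA gA] dA; apply: boolp.contrapT => H.
(* Taking the component of degree [N.+1 + K] leaves only the constant term of [t], which is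
   inverted. The extra factor ['X_l] puts the cofactor of ['X_p ^+ K.+1] in degree [N], which would
   otherwise be [N - 1]. *)
have H' K N c t : t@_0 != 0 -> ~ A ((t * 'X_l ^+ N - c * 'X_p) * 'X_p ^+ K).
  move=> t0 /(is_idealM 'X_l iA)/(gA (N.+1 + K)%N).
  have -> : 'X_l * ((t * 'X_l ^+ N - c * 'X_p) * 'X_p ^+ K) =
    t * ('X_l ^+ N.+1 * 'X_p ^+ K) - (c * 'X_l) * 'X_p ^+ K.+1.
    by rewrite !exprS; ring.
  rewrite raddfB /= -{1}[(N.+1 + K)%N]add0n projM ?dhomogM ?homogXn //.
  rewrite addSnnS projM ?homogXn // proj0 => /(is_idealZ (t@_0)^-1 iA) Ac.
  apply: H; exists K, N, ((t@_0)^-1 *: proj N (c * 'X_l)).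
  split; first by rewrite dhomogZ // pihomogP.
  move: Ac; rewrite scalerBr mul_mpolyC scalerA mulVf // scale1r.
  by rewrite -scalerAl.
pose A1 x := exists K c, A ((x - c * 'X_p) * 'X_p ^+ K).
have iA1 : is_ideal A1.
  split; first by exists 0%N, 0; rewrite mul0r subr0 mul0r; exact: is_ideal0.
  split=> [x y [K [c Ax]] [L [d Ay]] | r x [K [c Ax]]].
    exists (K + L)%N, (c + d).
    have -> : (x + y - (c + d) * 'X_p) * 'X_p ^+ (K + L) =
      'X_p ^+ L * ((x - c * 'X_p) * 'X_p ^+ K) +
      'X_p ^+ K * ((y - d * 'X_p) * 'X_p ^+ L) by rewrite exprD; ring.
    by apply: is_idealD => //; exact: is_idealM.
  exists K, (r * c).
  have -> : (r * x - r * c * 'X_p) * 'X_p ^+ K = r * ((x - c * 'X_p) * 'X_p ^+ K).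
    by ring.
  exact: is_idealM.
have AA1 x : A x -> A1 x.
  by exists 0%N, 0; rewrite mul0r subr0 expr0 mulr1.
have coef0M (s t : R) : (s * t)@_0 = s@_0 * t@_0 by rewrite rmorphM.
have [|||P1 [P1p A1P1 P1T]] := @prime_ideal_disjoint A1
    (fun x => exists N t, t@_0 != 0 /\ x = t * 'X_l ^+ N) iA1.
- by exists 0%N, 1; rewrite mcoeff1 eqxx oner_neq0 mul1r.
- move=> x y [N [s [s0 ->]]] [M [t [t0 ->]]]; exists (N + M)%N, (s * t).
  by rewrite coef0M mulf_neq0 //; split => //; rewrite exprD; ring.
- by move=> x [K [c Ax]] [N [t [t0 xE]]]; apply: (H' K N c t) => //; rewrite -xE.
have [iP1 [P1_1 P1M]] := P1p.
(* The set to avoid contains the complement of [P1], which gives [P0] inside [P1], and the powers of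
   ['X_p], which make the inclusion strict. *)
have [|||P0 [P0p AP0 P0T]] := @prime_ideal_disjoint A
    (fun x => exists K t, ~ P1 t /\ x = t * 'X_p ^+ K) iA.
- by exists 0%N, 1; rewrite mul1r.
- move=> x y [N [s [s0 ->]]] [M [t [t0 ->]]]; exists (N + M)%N, (s * t).
  by split; [case/P1M | rewrite exprD; ring].
- move=> x Ax [K [t [nP1 xE]]]; apply/nP1/A1P1.
  by exists K, 0; rewrite mul0r subr0 -xE.
apply: dA; exists P0, P1, (fun x => x@_0 = 0); split => //.
- split.
    split; first by rewrite mcoeff0.
    split=> [f g f0 g0 | r f f0]; first by rewrite mcoeffD f0 g0 addr0.
    by rewrite coef0M f0 mulr0.
  split; first by rewrite mcoeff1 eqxx; apply/eqP/oner_neq0.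
  by move=> f g /eqP; rewrite coef0M mulf_eq0 => /orP[]/eqP; [left | right].
split; split.
- move=> f P0f; apply: boolp.contrapT => nP1; apply: (P0T f) => //.
  by exists 0%N, f; rewrite mulr1.
- exists 'X_p; split.
    by apply: A1P1; exists 0%N, 1; rewrite mul1r subrr mul0r; exact: is_ideal0.
  by move=> /P0T; apply; exists 1%N, 1; rewrite mul1r.
- move=> f P1f; apply/eqP; apply: boolp.contrapT => /negP f0.
  by apply: (P1T f) => //; exists 0%N, f; rewrite mulr1.
- exists 'X_l; split; first by rewrite mcoeffX mnm1_eq0.
  by move=> /P1T; apply; exists 1%N, 1; rewrite mcoeff1 eqxx oner_neq0 mul1r.
Qed.

End Ideals.

(** * Standard monomials of the Rees algebra *)

Section Rees.
Variables (k : fieldType) (m p : nat) (s : 'I_p -> {mpoly k[m]}) (dg : 'I_p -> nat).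
Local Notation R := {mpoly k[m]}.
Local Notation mon := 'X_{1..(m + p)}.
Implicit Types (w v nu : mon) (F G H : {set 'I_m}) (P : mon -> Prop).

(** The first [m] variables are the x_j, the last [p] the y_j. The image is taken at t = 1; the
    exponent of t is recorded by [rees_deg]. *)
Definition rees_eval w : R :=
  \prod_(j < m) 'X_j ^+ w (lshift p j) * \prod_(j < p) s j ^+ w (rshift m j).

Definition rees_wt w : nat :=
  (\sum_(j < m) w (lshift p j) + \sum_(j < p) dg j * w (rshift m j))%N.

Definition rees_deg w : nat := (\sum_(j < p) w (rshift m j))%N.

Definition rees_span P (f : R) : Prop :=
  exists t : seq (k * mon), (forall cw, cw \in t -> P cw.2) /\
    f = \sum_(cw <- t) cw.1 *: rees_eval cw.2.

Lemma rees_evalD w v : rees_eval (w + v)%MM = rees_eval w * rees_eval v.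
Proof.
rewrite /rees_eval mulrACA -!big_split /=.
by congr (_ * _); apply: eq_bigr => j _; rewrite mnmDE exprD.
Qed.

Lemma rees_wtD w v : rees_wt (w + v)%MM = (rees_wt w + rees_wt v)%N.
Proof.
rewrite /rees_wt addnACA -!big_split /=.
by congr (_ + _)%N; apply: eq_bigr => j _; rewrite mnmDE // mulnDr.
Qed.

Lemma rees_degD w v : rees_deg (w + v)%MM = (rees_deg w + rees_deg v)%N.
Proof. by rewrite /rees_deg -big_split; apply: eq_bigr => j _; rewrite mnmDE. Qed.

Definition xmon (j : 'I_m) (a : nat) : mon := (U_(lshift p j) *+ a)%MM.

Lemma xmonl j a i : xmon j a (lshift p i) = ((j == i) * a)%N.
Proof. by rewrite /xmon mulmnE mnm1E (inj_eq (@lshift_inj _ _)). Qed.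

Lemma xmonr j a i : xmon j a (rshift m i) = 0%N.
Proof. by rewrite /xmon mulmnE mnm1E eq_lrshift mul0n. Qed.

Lemma rees_eval_xmon j a : rees_eval (xmon j a) = 'X_j ^+ a.
Proof.
rewrite /rees_eval [X in _ * X]big1 => [|i _]; last by rewrite xmonr expr0.
rewrite (bigD1 j) //= big1 => [|i /negPf ij]; last first.
  by rewrite xmonl eq_sym ij mul0n expr0.
by rewrite xmonl eqxx mul1n !mulr1.
Qed.

Lemma rees_span0 P : rees_span P 0.
Proof. by exists [::]; rewrite big_nil. Qed.

Lemma rees_spanD P f g : rees_span P f -> rees_span P g -> rees_span P (f + g).
Proof.
move=> [t [tP ->]] [u [uP ->]]; exists (t ++ u); split; last by rewrite big_cat.
by move=> cw; rewrite mem_cat => /orP[]; [exact: tP | exact: uP].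
Qed.

Lemma rees_spanZ P c f : rees_span P f -> rees_span P (c *: f).
Proof.
move=> [t [tP ->]]; exists [seq (c * cw.1, cw.2) | cw <- t]; split.
  by move=> _ /mapP[cw cwt ->]; exact: (tP cw).
by rewrite big_map scaler_sumr; apply: eq_bigr => cw _; rewrite scalerA.
Qed.

Lemma rees_span_eval P w : P w -> rees_span P (rees_eval w).
Proof.
move=> Pw; exists [:: (1, w)]; split; last by rewrite big_seq1 scale1r.
by move=> cw; rewrite inE => /eqP->.
Qed.

Lemma rees_span_ind P (K : R -> Prop) : K 0 ->
  (forall f g, K f -> K g -> K (f + g)) ->
  (forall c w, P w -> K (c *: rees_eval w)) ->
  forall f, rees_span P f -> K f.
Proof.
move=> K0 KD KP f [t [tP ->]]; rewrite big_seq; elim/big_ind: _ => //.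
by move=> cw /tP; exact: KP.
Qed.

Lemma rees_span_sub P (Q : mon -> Prop) f :
  (forall w, P w -> Q w) -> rees_span P f -> rees_span Q f.
Proof. by move=> PQ [t [tP ->]]; exists t; split => // cw /tP/PQ. Qed.

Lemma rees_span_sum P (X : Type) (t : seq X) (B : pred X) (f : X -> R) :
  (forall i, B i -> rees_span P (f i)) -> rees_span P (\sum_(i <- t | B i) f i).
Proof.
move=> h; elim/big_ind: _ => //; [exact: rees_span0 | exact: rees_spanD].
Qed.

Lemma rees_span_shift P (Q : mon -> Prop) v f :
  (forall w, P w -> Q (w + v)%MM) -> rees_span P f ->
  rees_span Q (f * rees_eval v).
Proof.
move=> PQ; move: f; apply: rees_span_ind => [|x y hx hy|c w /PQ Qw].
- by rewrite mul0r; exact: rees_span0.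
- by rewrite mulrDl; exact: rees_spanD.
- by rewrite -scalerAl -rees_evalD; apply: rees_spanZ; exact: rees_span_eval.
Qed.

Definition below nu w :=
  [/\ (w < nu)%O, rees_deg w = rees_deg nu & rees_wt w = rees_wt nu].

(* [w] is a monomial of the initial ideal of the kernel of
   [k[x, y] -> R[t], y_j |-> s_j t]. *)
Definition nonstandard w := rees_span (below w) (rees_eval w).

Lemma belowD v w nu : below nu w -> below (nu + v)%MM (w + v)%MM.
Proof.
by move=> [h1 h2 h3]; split; rewrite ?ltmc_add2l // ?rees_degD ?rees_wtD ?h2 ?h3.
Qed.

Lemma belowDK v w nu : below (nu + v)%MM (w + v)%MM -> below nu w.
Proof.
move=> []; rewrite ltmc_add2l !rees_degD !rees_wtD => h1 h2 h3.
by split => //; lia.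
Qed.

Lemma nonstandardD w v : nonstandard w -> nonstandard (w + v)%MM.
Proof.
by rewrite /nonstandard rees_evalD => h; apply: (rees_span_shift _ h) => u;
  exact: belowD.
Qed.

Section Level.
Variable a : nat.
Local Notation y := (fun j : 'I_m => 'X_j ^+ a : R).

(* A monomial [w] in the component [F] of the Koszul complex stands for the
   Laurent monomial [w / x_F^a]; [w * codenom F] is that monomial times
   [(x_1 ... x_m)^a]. *)
Definition codenom F : mon :=
  [multinom match split i with inl j => if j \in F then 0%N else a | inr _ => 0%N end
    | i < m + p].

Lemma codenoml F j : codenom F (lshift p j) = if j \in F then 0%N else a.
Proof. by rewrite mnmE -[lshift p j]/(unsplit (inl j)) unsplitK. Qed.

Lemma codenomr F j : codenom F (rshift m j) = 0%N.
Proof. by rewrite mnmE -[rshift m j]/(unsplit (inr j)) unsplitK. Qed.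

Lemma mon_split_lep w v :
  (forall j : 'I_m, w (lshift p j) <= v (lshift p j))%N ->
  (forall j : 'I_p, w (rshift m j) <= v (rshift m j))%N -> (w <= v)%MM.
Proof.
by move=> hl hr; apply/mnm_lepP => i; case: (split_ordP i) => j ->.
Qed.

Lemma mon_split_eq w v :
  (forall j : 'I_m, w (lshift p j) = v (lshift p j)) ->
  (forall j : 'I_p, w (rshift m j) = v (rshift m j)) -> w = v.
Proof. by move=> hl hr; apply/mnmP => i; case: (split_ordP i) => j ->. Qed.

Lemma codenomD1 l G : l \in G -> codenom (G :\ l) = (codenom G + xmon l a)%MM.
Proof.
move=> lG; apply: mon_split_eq => j.
  rewrite mnmDE !codenoml xmonl !inE [l == j]eq_sym.
  by case: eqVneq => [->|] /=; rewrite ?lG ?mul1n ?addn0.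
by rewrite mnmDE !codenomr xmonr.
Qed.

Lemma rees_deg_codenom F : rees_deg (codenom F) = 0%N.
Proof. by rewrite /rees_deg big1 // => j _; rewrite codenomr. Qed.

Lemma rees_wt_codenom F : (rees_wt (codenom F) + a * #|F| = a * m)%N.
Proof.
rewrite /rees_wt [X in (_ + X + _)%N]big1 => [|j _]; last first.
  by rewrite codenomr muln0.
rewrite addn0; under eq_bigr => j _ do rewrite codenoml.
rewrite (bigID (mem F)) /= big1 => [|j ->] //; rewrite add0n.
rewrite (eq_bigr (fun=> a)) => [|j /negPf->] //.
rewrite sum_nat_const mulnC -mulnDr -[in RHS](card_ord m) -(cardC (mem F)).
by rewrite addnC.
Qed.

(** In one multidegree [nu] each component [F] carries a single monomial, so the complex becomes one
    of scalars. The hypothesis guards against truncated subtraction of exponents. *)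
Lemma koszul_d_scaled nu (c : {set 'I_m} -> k) F :
  (forall H, c H != 0 -> (codenom H <= nu)%MM) ->
  koszul_d y (fun H => c H *: rees_eval (nu - codenom H)%MM) F =
  koszul_d (fun=> 1) (fun H => (c H)%:MP) F * rees_eval (nu - codenom F)%MM.
Proof.
move=> hc; rewrite /koszul_d mulr_suml; apply: eq_bigr => l lF.
rewrite mulr1 -mul_mpolyC -2!(mulrA (csign k l F)) -(mulrA (c _)%:MP).
have [->|/hc le] := eqVneq (c (F :\ l)) 0; first by rewrite !mul0r.
rewrite /= -rees_eval_xmon -rees_evalD; congr (_ * (_ * rees_eval _)).
apply/mnmP => i; move/mnm_lepP/(_ i): le.
by rewrite (codenomD1 lF) !(mnmDE, mnmBE); lia.
Qed.

Lemma koszul_dD (f g : {set 'I_m} -> R) G :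
  koszul_d y (fun F => f F + g F) G = koszul_d y f G + koszul_d y g G.
Proof.
by rewrite /koszul_d -big_split; apply: eq_bigr => l _; rewrite mulrDr mulrDl.
Qed.

Lemma koszul_dB (f g : {set 'I_m} -> R) G :
  koszul_d y (fun F => f F - g F) G = koszul_d y f G - koszul_d y g G.
Proof.
by rewrite /koszul_d -sumrB; apply: eq_bigr => l _; rewrite mulrBr mulrBl.
Qed.

Lemma csignZ j G (f : R) : csign k j G * f = (-1) ^+ #|[set i in G | (i < j)%N]| *: f.
Proof. by rewrite /csign -mul_mpolyC rmorphXn /= rmorphN1. Qed.

Lemma csignC j G : csign k j G = ((-1) ^+ #|[set i in G | (i < j)%N]|)%:MP.
Proof. by rewrite -[LHS]mulr1 csignZ -mul_mpolyC mulr1. Qed.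

(** The factor ['X_l ^+ a] makes up for the difference of the two values of [codenom], so the
    differential preserves Laurent monomials. *)
Lemma koszul_d_below nu (f : {set 'I_m} -> R) G :
  (forall l, l \in G ->
     rees_span (fun w => below nu (w + codenom (G :\ l))%MM) (f (G :\ l))) ->
  rees_span (fun w => below nu (w + codenom G)%MM) (koszul_d y f G).
Proof.
move=> h; apply: rees_span_sum => l lG.
rewrite -mulrA csignZ; apply: rees_spanZ; rewrite -rees_eval_xmon.
apply: rees_span_shift (h l lG) => w.
by rewrite (codenomD1 lG) -!addmA [(xmon l a + _)%MM]addmC.
Qed.

Lemma rees_span_below nu F w f : (w + codenom F)%MM = nu ->
  rees_span (below w) f <-> rees_span (fun w => below nu (w + codenom F)%MM) f.
Proof.
by move=> <-; split; apply: rees_span_sub => v; [exact: belowD | exact: belowDK].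
Qed.

(* Replaces the part of [f] on [nu] by something smaller: multiplication by
   [x_j] preserves standard monomials with large [j]-exponent, so the complex
   of standard monomials in degree [nu] is contracted along [j]. *)
Lemma koszul_reduce (N i : nat) (j : 'I_m) nu (f : {set 'I_m} -> R) :
  (forall w (i : 'I_(m + p)) b, (N <= w i)%N ->
     nonstandard (w + U_(i) *+ b)%MM -> nonstandard w) ->
  (a + N <= nu (lshift p j))%N ->
  (forall F, #|F| = i -> rees_span (fun w =>
      (w + codenom F)%MM = nu \/ below nu (w + codenom F)%MM) (f F)) ->
  (forall G, #|G| = i.+1 -> koszul_d y f G = 0) ->
  exists g : {set 'I_m} -> R,
    (forall H, rees_span (fun w => (w + codenom H)%MM = nu) (g H)) /\
    (forall F, #|F| = i ->
       rees_span (fun w => below nu (w + codenom F)%MM) (f F - koszul_d y g F)).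
Proof.
move=> Nspec jnu fspan fcocycle.
pose w0 F := (nu - codenom F)%MM.
have w0K F : (codenom F <= nu)%MM -> (w0 F + codenom F)%MM = nu.
  exact: submK.
(* [c F] is the coefficient of [f F] at [nu]. It is set to 0 when the monomial is nonstandard, since
   that monomial then rewrites into smaller ones. *)
have /boolp.choice[c c_spec] : forall F, exists c : k,
    (#|F| = i -> rees_span (fun w => below nu (w + codenom F)%MM)
       (f F - c *: rees_eval (w0 F))) /\
    (c != 0 -> (codenom F <= nu)%MM /\ ~ nonstandard (w0 F)).
  move=> F; have [Fi|Fi] := eqVneq #|F| i; last first.
    by exists 0; split; [move/eqP: Fi | rewrite eqxx].
  pose K u := exists c : k,
      rees_span (fun w => below nu (w + codenom F)%MM) (u - c *: rees_eval (w0 F)) /\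
      (c != 0 -> (codenom F <= nu)%MM).
  have [c [hf hc]] : K (f F).
    apply: (rees_span_ind (K := K) _ _ _ (fspan F Fi)).
    - by exists 0; rewrite scale0r subr0 eqxx; split => //; exact: rees_span0.
    - move=> u v [c [hu hc]] [d [hv hd]]; exists (c + d); split.
        by rewrite scalerDl opprD addrACA; exact: rees_spanD.
      by have [->|/hc //] := eqVneq c 0; rewrite add0r => /hd.
    - move=> c w [wE|wB].
        have le : (codenom F <= nu)%MM by rewrite -wE lem_addl.
        exists c; split=> //.
        have -> : w0 F = w by rewrite /w0 -wE addmK.
        by rewrite subrr; exact: rees_span0.
      exists 0; rewrite scale0r subr0 eqxx; split => //.
      by apply: rees_spanZ; exact: rees_span_eval.
  have [ns|ns] := boolp.EM (nonstandard (w0 F)); last by exists c; split => // /hc.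
  exists 0; rewrite eqxx scale0r subr0; split=> // _.
  have [c0|/hc le] := eqVneq c 0; first by rewrite c0 scale0r subr0 in hf.
  rewrite -[f F](subrK (c *: rees_eval (w0 F))); apply: rees_spanD => //.
  by apply/rees_spanZ/(rees_span_below _ (w0K _ le)).
have c_le F : c F != 0 -> (codenom F <= nu)%MM by case/(proj2 (c_spec F)).
pose gam H : k := if j \in H then 0 else
  (-1) ^+ #|[set l in j |: H | (l < j)%N]| * c (j |: H).
(* The x_j-exponent of [nu] is at least [a], so dropping [j] from the index set preserves
   divisibility. *)
have le_cof F : (codenom (j |: F) <= nu)%MM -> (codenom F <= nu)%MM.
  move=> /mnm_lepP h; apply: mon_split_lep => l; last by rewrite codenomr.
  move: (h (lshift p l)); rewrite !codenoml !inE.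
  by case: eqVneq => [->|] //= _; case: ifP => // _; lia.
have gam_le H : gam H != 0 -> (codenom H <= nu)%MM.
  rewrite /gam; case: ifP => [|_]; first by rewrite eqxx.
  by rewrite mulf_eq0 => /norP[_ /c_le/le_cof].
exists (fun H => gam H *: rees_eval (w0 H)); split.
  move=> H; have [->|/gam_le le] := eqVneq (gam H) 0.
    by rewrite scale0r; exact: rees_span0.
  by apply/rees_spanZ/rees_span_eval/w0K.
move=> F Fi; rewrite (koszul_d_scaled F gam_le).
have -> : koszul_d (fun=> 1) (fun H => (gam H)%:MP) F =
    koszul_d (fun=> 1) (contraction j (fun H => (c H)%:MP)) F.
  apply: eq_bigr => l lF; congr (_ * _ * _).
  rewrite /contraction /gam; case: ifP => _; first by rewrite mpolyC0.
  by rewrite csignC mpolyCM.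
(* By the homotopy identity, f - d g is [f] minus its part on [nu], plus a term coming from d c at
   [j |: F]; only the latter remains to be bounded. *)
rewrite koszul_d_contraction mul1r mulrBl opprB addrCA addrC.
rewrite mul_mpolyC; apply: rees_spanD; first by apply: (proj1 (c_spec F)).
have [jF|jF] := boolP (j \in F); first by rewrite mul0r; exact: rees_span0.
rewrite -mulrA csignZ; apply: rees_spanZ.
set G := j |: F; have Gi : #|G| = i.+1 by rewrite cardsU1 jF Fi.
pose C : k := \sum_(l in G) (-1) ^+ #|[set i in G | (i < l)%N]| * c (G :\ l).
have CE : koszul_d (fun=> 1) (fun H => (c H)%:MP) G = C%:MP.
  rewrite /C raddf_sum; apply: eq_bigr => l _.
  by rewrite /= mulr1 csignC mpolyCM.
rewrite CE mul_mpolyC; have [->|C0] := eqVneq C 0.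
  by rewrite scale0r; exact: rees_span0.
apply: rees_spanZ.
have [l lG /c_le le] : exists2 l, l \in G & c (G :\ l) != 0.
  apply: boolp.contrapT => h; move/eqP: C0; apply; apply: big1 => l lG.
  have [->|cl] := eqVneq (c (G :\ l)) 0; first by rewrite mulr0.
  by case: h; exists l.
have leG : (codenom G <= nu)%MM.
  by apply: lepm_trans le; rewrite (codenomD1 lG) lem_addr.
have leF : (codenom F <= nu)%MM by exact: le_cof.
have w0G : w0 G = (w0 F + U_(lshift p j) *+ a)%MM.
  have FG : F = G :\ j by rewrite setU1K.
  apply/mnmP => x; move/mnm_lepP/(_ x): leF.
  rewrite /w0 FG (codenomD1 (setU11 j F)) /xmon -/G.
  by rewrite !(mnmDE, mnmBE); lia.
(* When d c does not vanish at [G], the cocycle condition expresses the monomial [w0 G] by smaller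
   ones. As [w0 F] has x_j-exponent at least [N], [Nspec] carries nonstandardness from [w0 G] down
   to [w0 F]. *)
suff nsG : nonstandard (w0 G).
  apply/(rees_span_below _ (w0K _ leF)).
  apply: (Nspec (w0 F) (lshift p j) a); last by rewrite -w0G.
  by rewrite /w0 mnmBE codenoml (negPf jF); lia.
have : rees_span (fun w => below nu (w + codenom G)%MM)
    (koszul_d y (fun H => f H - c H *: rees_eval (w0 H)) G).
  apply: koszul_d_below => h hG; apply: (proj1 (c_spec _)).
  by move: Gi; rewrite (cardsD1 h G) hG => -[].
rewrite koszul_dB fcocycle // sub0r (koszul_d_scaled G c_le) CE mul_mpolyC.
move=> /(rees_spanZ (- C^-1)); rewrite scaleNr scalerN opprK scalerA mulVf //.
by rewrite scale1r => /(rees_span_below _ (w0K _ leG)).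
Qed.

End Level.
End Rees.

(** * Exactness of the Koszul complexes in large degree *)

Section Vanishing.
Variables (k : fieldType) (m p : nat) (s : 'I_p -> {mpoly k[m]}) (dg : 'I_p -> nat).
Local Notation R := {mpoly k[m]}.
Local Notation mon := 'X_{1..(m + p)}.
Implicit Types (F G H : {set 'I_m}) (w nu : mon).

Lemma mon_seq_max (L : seq mon) :
  L = [::] \/ exists2 nu, nu \in L & forall w, w \in L -> (w <= nu)%O.
Proof.
elim: L => [|w L [->|[nu nuL nuP]]]; [by left | right | right].
  by exists w; rewrite ?mem_head // => v; rewrite inE => /eqP->.
have [le|/ltW le] := leP w nu.
  exists nu; first by rewrite inE nuL orbT.
  by move=> v; rewrite inE => /orP[/eqP->|/nuP].
exists w; first exact: mem_head.
by move=> v; rewrite inE => /orP[/eqP->|/nuP/le_trans]; last apply.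
Qed.

Lemma rees_span_max (a i : nat) (B : {set 'I_m} -> mon -> Prop)
    (f : {set 'I_m} -> R) :
  (forall F, #|F| = i -> rees_span s (B F) (f F)) ->
  (forall F, #|F| = i -> f F = 0) \/
  exists nu, (exists F w, B F w /\ nu = (w + codenom p a F)%MM) /\
    forall F, #|F| = i ->
      rees_span s (fun w => B F w /\ ((w + codenom p a F)%MM <= nu)%O) (f F).
Proof.
move=> h.
have /boolp.choice[t tP] : forall F, exists t : seq (k * mon), #|F| = i ->
    (forall cw, cw \in t -> B F cw.2) /\
    f F = \sum_(cw <- t) cw.1 *: rees_eval s cw.2.
  move=> F; have [Fi|/eqP Fi] := eqVneq #|F| i; last by exists [::].
  by have [t tP] := h F Fi; exists t.
pose L := flatten [seq [seq (cw.2 + codenom p a F)%MM | cw <- t F] |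
  F <- enum [set F : {set 'I_m} | #|F| == i]].
have inL F cw : #|F| = i -> cw \in t F -> (cw.2 + codenom p a F)%MM \in L.
  move=> Fi cwt; apply/flatten_mapP; exists F; first by rewrite mem_enum inE Fi.
  by apply/mapP; exists cw.
have [L0|[nu nuL nuP]] := mon_seq_max L; [left|right].
  move=> F Fi; rewrite (proj2 (tP F Fi)) big1_seq // => cw /andP[_ cwt].
  by have := inL F cw Fi cwt; rewrite L0.
exists nu; split.
  case/flatten_mapP: nuL => F; rewrite mem_enum inE => /eqP Fi /mapP[cw cwt ->].
  by exists F, cw.2; split => //; apply: (proj1 (tP F Fi)).
move=> F Fi; have [tB ->] := tP F Fi; exists (t F); split => // cw cwt.
by split; [exact: tB | apply: nuP; exact: inL].
Qed.

(** [N] depends only on the set of nonstandard monomials, hence serves every [n] and every level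
    [a]. Each use of [koszul_reduce] strictly lowers the leading Laurent monomial of the cocycle. *)
Lemma koszul_vanishing : exists N : nat, forall (D n a i : nat) (r : int)
    (f : {set 'I_m} -> R),
  (forall j, dg j <= D)%N -> (D * n + m * N)%N%:Z < r ->
  (forall F, #|F| = i -> rees_span s
     (fun w => rees_deg w = n /\ (rees_wt dg w)%:Z = r + (a * i)%N%:Z) (f F)) ->
  (forall G, #|G| = i.+1 -> koszul_d (fun j => 'X_j ^+ a) f G = 0) ->
  exists g : {set 'I_m} -> R,
    (forall H, #|H|.+1 = i -> rees_span s
       (fun w => rees_deg w = n /\ (rees_wt dg w)%:Z = r + (a * #|H|)%N%:Z) (g H)) /\
    (forall F, #|F| = i -> f F = koszul_d (fun j => 'X_j ^+ a) g F).
Proof.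
have [N Nspec] := @dickson_mnm (m + p) (nonstandard s dg)
  (fun w v => @nonstandardD _ _ _ s dg w v).
exists N => D n a i r f dgD rbig fspan fcocycle.
(* Adding [codenom] brings the components for all [F] to the common weight [r + a m]. *)
pose good nu := rees_deg nu = n /\ (rees_wt dg nu)%:Z = r + (a * m)%N%:Z.
pose B F w := good (w + codenom p a F)%MM.
have BP F w : B F w <-> rees_deg w = n /\ (rees_wt dg w)%:Z = r + (a * #|F|)%N%:Z.
  rewrite /B /good rees_degD rees_wtD rees_deg_codenom addn0.
  by have := rees_wt_codenom dg a F; split=> -[-> ?]; split => //; lia.
have {}fspan F : #|F| = i -> rees_span s (B F) (f F).
  by move=> Fi; apply: rees_span_sub (fspan F Fi) => w; rewrite BP Fi.
suff [g [gB gE]] : exists g : {set 'I_m} -> R,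
    (forall H, rees_span s (B H) (g H)) /\
    (forall F, #|F| = i -> f F = koszul_d (fun j => 'X_j ^+ a) g F).
  by exists g; split => // H _; apply: rees_span_sub (gB H) => w; rewrite BP.
have main nu : good nu -> forall f, (forall F, #|F| = i ->
     rees_span s (fun w => B F w /\ ((w + codenom p a F)%MM <= nu)%O) (f F)) ->
    (forall G, #|G| = i.+1 -> koszul_d (fun j => 'X_j ^+ a) f G = 0) ->
    exists g : {set 'I_m} -> R, (forall H, rees_span s (B H) (g H)) /\
      (forall F, #|F| = i -> f F = koszul_d (fun j => 'X_j ^+ a) g F).
  elim/(well_founded_ind (@ltom_wf (m + p))): nu => nu IH nug {}f {}fspan {}fcocycle.
  (* Pigeonhole: the weight of [nu] exceeds [D n + m (a + N)] and its y-part accounts for at most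
     [D n]. *)
  have [j jnu] : exists j, (a + N <= nu (lshift p j))%N.
    apply: boolp.contrapT => h.
    have h1 : (\sum_(j < m) nu (lshift p j) <= \sum_(j < m) (a + N))%N.
      apply: leq_sum => j _; rewrite leqNgt; apply/negP => lt.
      by apply: h; exists j; exact: ltnW.
    have h2 : (\sum_(j < p) dg j * nu (rshift m j) <= D * n)%N.
      rewrite -(proj1 nug) /rees_deg big_distrr /=.
      by apply: leq_sum => j _; rewrite leq_mul2r dgD orbT.
    move: (proj2 nug) h1 h2 rbig; rewrite /rees_wt sum_nat_const card_ord.
    by rewrite mulnDr [(m * a)%N]mulnC; lia.
  have [|g [gspan gB]] := koszul_reduce Nspec jnu _ fcocycle.
    move=> F Fi; apply: rees_span_sub (fspan F Fi) => w [[wn wt]].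
    rewrite le_eqVlt => /orP[/eqP|lt]; [by left | right].
    by split => //; rewrite ?wn ?(proj1 nug) //; move: (proj2 nug); lia.
  have {}gspan H : rees_span s (B H) (g H).
    by apply: rees_span_sub (gspan H) => w; rewrite /B => ->.
  pose f' F := f F - koszul_d (fun j => 'X_j ^+ a) g F.
  have f'co G : #|G| = i.+1 -> koszul_d (fun j => 'X_j ^+ a) f' G = 0.
    by move=> Gi; rewrite koszul_dB fcocycle // koszul_dd subr0.
  have f'B F : #|F| = i -> rees_span s
      (fun w => B F w /\ ((w + codenom p a F)%MM < nu)%O) (f' F).
    move=> Fi; apply: rees_span_sub (gB F Fi) => w [lt wn wt]; split => //.
    by split; rewrite ?wn ?wt; case: nug.
  have [f'0|[nu' [[F0 [w0 [[B0 lt0] ->]]] f'le]]] := rees_span_max a f'B.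
    exists g; split => // F Fi; apply/eqP; rewrite -subr_eq0; apply/eqP.
    exact: f'0.
  have [|g' [g'B g'E]] := IH _ lt0 B0 f' _ f'co.
    by move=> F Fi; apply: rees_span_sub (f'le F Fi) => w [[]].
  exists (fun F => g F + g' F); split.
    by move=> H; apply: rees_spanD.
  by move=> F Fi; rewrite koszul_dD -g'E // addrC subrK.
have [f0|[nu [[F [w [wB ->]]] fle]]] := rees_span_max a fspan; last exact: main fle _.
exists (fun=> 0); split; first by move=> H; exact: rees_span0.
by move=> F Fi; rewrite f0 // /koszul_d big1 // => l _; rewrite mulr0 mul0r.
Qed.

End Vanishing.

(** * Vanishing of Cech cohomology *)

Section Vanish.
Variables (k : fieldType) (m : nat).
Local Notation R := {mpoly k[m]}.
Local Notation pow a := (fun j : 'I_m => 'X_j ^+ a : {mpoly k[m]}).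
Implicit Types (E J S : R -> Prop) (F G H : {set 'I_m}) (f g : {set 'I_m} -> R).

Lemma homog_int0 d : homog_int d (0 : R). Proof. by left. Qed.

Lemma homog_intD d (x y : R) : homog_int d x -> homog_int d y -> homog_int d (x + y).
Proof.
move=> [->|[n [-> xn]]]; first by rewrite add0r.
move=> [->|[l [[<-] yn]]]; first by rewrite addr0; right; exists n.
by right; exists n; split => //; exact: dhomogD.
Qed.

Lemma homog_intM d e (x y : R) : homog_int d x -> y \is e.-homog ->
  homog_int (d + e%:Z) (x * y).
Proof.
move=> [->|[n [-> xn]]] ye; first by rewrite mul0r; left.
by right; exists (n + e)%N; split; [rewrite PoszD | exact: dhomogM].
Qed.

Lemma homog_intZ d (c : k) (x : R) : homog_int d x -> homog_int d (c *: x).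
Proof.
move=> [->|[n [-> xn]]]; first by rewrite scaler0; left.
by right; exists n; split => //; exact: dhomogZ.
Qed.

Lemma homog_intB d (x y : R) : homog_int d x -> homog_int d y -> homog_int d (x - y).
Proof.
by move=> hx hy; apply: homog_intD => //; rewrite -scaleN1r; exact: homog_intZ.
Qed.

Lemma homog_int_sum d (X : Type) (t : seq X) (B : pred X) (x : X -> R) :
  (forall i, B i -> homog_int d (x i)) -> homog_int d (\sum_(i <- t | B i) x i).
Proof.
by move=> h; elim/big_ind: _ => //; [exact: homog_int0 | move=> *; exact: homog_intD].
Qed.

Lemma xpowD F a b : xpow k F (a + b) = xpow k F a * xpow k F b.
Proof. by rewrite /xpow -big_split; apply: eq_bigr => j _; rewrite exprD. Qed.

Lemma xpowD1 F l a : l \in F -> xpow k F a = 'X_l ^+ a * xpow k (F :\ l) a.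
Proof. by move=> lF; rewrite /xpow (big_setD1 l). Qed.

Lemma xpow_homog F a : xpow k F a \is (a * #|F|).-homog.
Proof.
rewrite -sum1_card big_distrr /= /xpow.
elim/big_ind2: _ => [|x n y l xn yl|j _]; first exact: dhomog1.
  exact: dhomogM.
by rewrite muln1; exact: homogXn.
Qed.

(** These are the transition maps of the direct system whose limit is the Cech complex: multiplying
    by [x_F^c] rewrites a fraction over [x_F^(a+c)]. *)
Lemma koszul_d_xpow a c f G :
  koszul_d (pow (a + c)) (fun F => f F * xpow k F c) G =
  koszul_d (pow a) f G * xpow k G c.
Proof.
rewrite /koszul_d mulr_suml; apply: eq_bigr => l lG.
by rewrite (xpowD1 _ lG) exprD; ring.
Qed.

Lemma koszul_dMr y f (c : R) G :
  koszul_d y (fun F => f F * c) G = koszul_d y f G * c.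
Proof. by rewrite /koszul_d mulr_suml; apply: eq_bigr => l _; ring. Qed.

Lemma koszul_d0 (y : 'I_m -> R) G : koszul_d y (fun=> 0) G = 0.
Proof. by rewrite /koszul_d big1 // => l _; rewrite mulr0 mul0r. Qed.

Lemma koszul_d_ideal S y f G : is_ideal S ->
  (forall l, l \in G -> S (f (G :\ l))) -> S (koszul_d y f G).
Proof.
move=> iS h; apply: ideal_sum => // l /h Sf.
by apply: is_idealMr => //; apply: is_idealM.
Qed.

Lemma koszul_d_homog d a f G :
  (forall l, l \in G -> homog_int d (f (G :\ l))) ->
  homog_int (d + a%:Z) (koszul_d (pow a) f G).
Proof.
move=> h; apply: homog_int_sum => l lG; apply: homog_intM (homogXn _ _ _).
by rewrite csignZ; apply/homog_intZ/h.
Qed.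

(* [cochain S i r a f] says that [f] is a degree [r] cochain [(f_F / x_F^a)]. *)
Definition cochain S (i : nat) (r : int) (a : nat) f :=
  forall F, #|F| = i -> S (f F) /\ homog_int (r + (a * i)%N%:Z) (f F).

(** Exactness in the direct limit: a cocycle of level [a] may become a boundary only at level
    [a + c]. For [i = 0] the boundary is an empty sum and [g] is unconstrained. *)
Definition cech_vanishing S (i : nat) (r : int) := forall a f,
  cochain S i r a f -> (forall G, #|G| = i.+1 -> koszul_d (pow a) f G = 0) ->
  exists c g, (forall i', i = i'.+1 -> cochain S i' r (a + c) g) /\
    forall F, #|F| = i -> f F * xpow k F c = koszul_d (pow (a + c)) g F.

Lemma cech_vanishing_coboundary S i r a f : cech_vanishing S i r ->
  cech_cocycle S i r a f -> cech_coboundary S i r a f.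
Proof.
move=> van [fS fc]; have [c [g [gS gE]]] := van a f fS fc.
case: i fS {fc van} gS gE => [|i] fS gS gE.
  move=> F F0; have := gE F F0; move/eqP: F0; rewrite cards_eq0 => /eqP->.
  by rewrite /xpow /koszul_d !big_set0 mulr1.
exists (a + c)%N, g; split; first exact: gS.
by move=> F Fi; rewrite xpowD mulrCA gE // mulrC.
Qed.

(** The hypothesis on cocycles says that H^i(S') -> H^i(S) is onto in degree [r], so vanishing
    passes from [S'] to [S]. *)
Lemma cech_vanishing_step S S' i r : is_ideal S -> (forall x, S' x -> S x) ->
  (forall a f, cochain S i r a f ->
     (forall G, #|G| = i.+1 -> koszul_d (pow a) f G = 0) ->
     exists c g, (forall i', i = i'.+1 -> cochain S i' r (a + c) g) /\
       forall F, #|F| = i -> S' (f F * xpow k F c - koszul_d (pow (a + c)) g F)) ->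
  cech_vanishing S' i r -> cech_vanishing S i r.
Proof.
move=> iS SS' step van a f fS fc; have [c [g [gS gE]]] := step a f fS fc.
pose f' F := f F * xpow k F c - koszul_d (pow (a + c)) g F.
have [||c' [g' [g'S g'E]]] := van (a + c)%N f'.
- move=> F Fi; split; first exact: gE.
  apply: homog_intB.
    have := homog_intM (proj2 (fS F Fi)) (xpow_homog F c).
    by rewrite Fi -addrA -PoszD -mulnDl.
  case: i {fc van step} fS gS gE Fi => [|i] fS gS gE Fi.
    move/eqP: Fi; rewrite cards_eq0 => /eqP->.
    by rewrite /koszul_d big_set0; left.
  have -> : r + ((a + c) * i.+1)%N%:Z = r + ((a + c) * i)%N%:Z + (a + c)%N%:Z.
    by rewrite mulnS PoszD; ring.
  apply: koszul_d_homog => l lF; apply: (proj2 (gS i erefl _ _)).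
  by move: Fi; rewrite (cardsD1 l F) lF => -[].
- by move=> G Gi; rewrite koszul_dB koszul_d_xpow fc // mul0r koszul_dd subrr.
exists (c + c')%N, (fun F => g F * xpow k F c' + g' F); split.
  move=> i' ii' F Fi'; have [Sg hg] := gS _ ii' _ Fi'.
  have [Sg' hg'] := g'S _ ii' _ Fi'; rewrite addnA; split.
    by apply: is_idealD => //; [exact: is_idealMr | exact: SS'].
  apply: homog_intD => //.
  have := homog_intM hg (xpow_homog F c').
  by rewrite Fi' -addrA -PoszD -mulnDl.
move=> F Fi; rewrite addnA koszul_dD koszul_d_xpow -g'E // -mulrDl /f'.
by rewrite addrCA subrr addr0 xpowD mulrA.
Qed.

(** [symb_pow I J n] is convertible to this with [E = ideal_pow I n]. *)
Definition saturation E J : R -> Prop :=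
  fun x => exists r, forall y, ideal_pow J r y -> E (x * y).

Lemma saturation_sub E J x : is_ideal E -> E x -> saturation E J x.
Proof. by move=> iE Ex; exists 0%N => y _; exact: is_idealMr. Qed.

Lemma saturation_ideal E J : is_ideal E -> is_ideal (saturation E J).
Proof.
move=> iE; split; first exact: saturation_sub (is_ideal0 iE).
split=> [x y [a hx] [b hy] | c x [a hx]].
  exists (a + b)%N => z Jz; rewrite mulrDl; apply: is_idealD => //.
    by apply: hx; exact: ideal_pow_sub Jz.
  by apply: hy; rewrite addnC in Jz; exact: ideal_pow_sub Jz.
by exists a => z /hx; rewrite -mulrA; exact: is_idealM.
Qed.

Lemma leq_sum_fin (X : finType) (x : X) (u : X -> nat) : (u x <= \sum_y u y)%N.
Proof. by rewrite (bigD1 x) //= leq_addr. Qed.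

Lemma saturation_uniform E J (X : finType) (u : X -> R) : is_ideal E ->
  (forall x, saturation E J (u x)) ->
  exists r, forall x y, ideal_pow J r y -> E (u x * y).
Proof.
move=> iE /boolp.choice[r hr]; exists (\sum_x r x)%N => x y Jy; apply: hr.
have := leq_sum_fin x r => /subnKC e; rewrite -e in Jy.
exact: ideal_pow_sub Jy.
Qed.

(** A single power of [J] carries all the components into [E], hence lies in their annihilator; a
    prime over the annihilator is then a prime over [J]. *)
Lemma annihilator_dim_le1 E J i f : is_ideal E -> dim_quot_le1 J ->
  (forall F, #|F| = i -> saturation E J (f F)) ->
  dim_quot_le1 (fun q => forall F, #|F| = i -> E (f F * q)).
Proof.
move=> iE dJ fS; pose u F := if #|F| == i then f F else 0.
have [|r hr] := @saturation_uniform E J _ u iE.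
  move=> F; rewrite /u; case: eqP => [/fS //|_].
  exact: is_ideal0 (saturation_ideal J iE).
move=> [P0 [P1 [P2 [p0 p1 p2 AP inc]]]]; apply: dJ; exists P0, P1, P2; split => //.
apply: (prime_ideal_pow p0 (r := r)) => y Jy; apply: AP => F Fi.
by have := hr F y Jy; rewrite /u Fi eqxx.
Qed.

Section TorsionStep.
Variables (E J S : R -> Prop) (p : 'I_m).
Hypotheses (gE : graded_ideal E) (dJ : dim_quot_le1 J) (iS : is_ideal S)
  (Ssat : forall x, S x -> saturation E J x).

(** The components are homogeneous, so their annihilator modulo [E] is graded and [dim_le1_relation]
    applies to each [l]. Summing exponents over [l] makes [K] and [N] uniform; iterating [a] times
    produces the factor ['X_p ^+ a] of the Koszul differential. *)
Lemma annihilator_relation i r a f : cochain S i r a f ->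
  exists K N (c : 'I_m -> R), (forall l, c l \is (N * a).-homog) /\
    forall l F, #|F| = i ->
      E (f F * ('X_l ^+ (N.+1 * a) * 'X_p ^+ K - c l * 'X_p ^+ (K + a))).
Proof.
move=> fS; have iE := proj1 gE.
pose A q := forall F, #|F| = i -> E (f F * q).
have gA : graded_ideal A.
  split.
    split; first by move=> F _; rewrite mulr0; exact: is_ideal0.
    split=> [x y hx hy F Fi | x y hy F Fi].
      by rewrite mulrDr; apply: is_idealD; [|exact: hx|exact: hy].
    by rewrite mulrCA; apply: is_idealM => //; exact: hy.
  move=> d q hq F Fi; have [_ [->|[e [_ fe]]]] := fS F Fi.
    by rewrite mul0r; exact: is_ideal0.
  by rewrite mulrC -(projM d q fe); apply: (proj2 gE); rewrite mulrC; exact: hq.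
have dA : dim_quot_le1 A.
  exact: annihilator_dim_le1 iE dJ (fun F Fi => Ssat (proj1 (fS F Fi))).
have iA := proj1 gA.
have /boolp.choice[t tP] : forall l, exists t : nat * nat * R,
    t.2 \is t.1.2.-homog /\
    A ('X_l ^+ t.1.2.+1 * 'X_p ^+ t.1.1 - t.2 * 'X_p ^+ t.1.1.+1).
  move=> l; have [K [N [c h]]] := dim_le1_relation p l gA dA.
  by exists (K, N, c).
pose K := (\sum_l (t l).1.1)%N; pose N := (\sum_l (t l).1.2)%N.
pose c l := 'X_l ^+ (N - (t l).1.2) * (t l).2.
have cN l : c l \is N.-homog.
  have [h _] := tP l; have := dhomogM (homogXn k l (N - (t l).1.2)) h.
  by rewrite subnK // (leq_sum_fin l (fun l => (t l).1.2)).
have cA l : A ('X_l ^+ N.+1 * 'X_p ^+ K - c l * 'X_p ^+ K.+1).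
  have [_] := tP l; rewrite /c.
  have KE : K = (K - (t l).1.1 + (t l).1.1)%N.
    by rewrite subnK // (leq_sum_fin l (fun l => (t l).1.1)).
  have NE : N.+1 = (N - (t l).1.2 + (t l).1.2.+1)%N.
    by rewrite addnS subnK // (leq_sum_fin l (fun l => (t l).1.2)).
  move/(is_idealM ('X_l ^+ (N - (t l).1.2) * 'X_p ^+ (K - (t l).1.1)) iA).
  by rewrite [in X in _ -> X]KE NE -!addnS !exprD; congr A; ring.
exists K, N, (fun l => c l ^+ a); split; first by move=> l; apply: dhomogMn.
move=> l F Fi; move: F Fi; rewrite -/(A _).
elim: a {fS} => [|a IH].
  by rewrite muln0 addn0 !expr0 !mul1r subrr; exact: is_ideal0.
have := is_idealD iA (is_idealM (c l * 'X_p) iA IH)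
  (is_idealM ('X_l ^+ (N.+1 * a)) iA (cA l)).
by rewrite mulnS addnS exprD !exprS; congr A; rewrite !exprD; ring.
Qed.

(** For a cocycle, the contraction [h] along [p] satisfies d h = x_p^a f, so [f] is a coboundary
    once ['X_p] is inverted. The relations replace the division: [h H * x_H^b] and [x_p^a * g H]
    agree modulo [E] after multiplication by ['X_p ^+ K]. An index of [H] is chosen for this, and
    [H] is nonempty because the cohomological degree is at least 2. *)
Lemma torsion_step i r a f : cochain S i.+2 r a f ->
  (forall G, #|G| = i.+3 -> koszul_d (pow a) f G = 0) ->
  exists c g, cochain S i.+1 r (a + c) g /\
    forall F, #|F| = i.+2 -> exists K,
      E ((f F * xpow k F c - koszul_d (pow (a + c)) g F) * 'X_p ^+ K).
Proof.
move=> fS fc; have iE := proj1 gE.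
have [K [N [c [cN cE]]]] := annihilator_relation fS.
pose b := (N.+1 * a)%N; pose h := contraction p f.
pose l_ H := odflt p [pick l in H].
have l_in H : #|H| = i.+1 -> l_ H \in H.
  rewrite /l_; case: pickP => //= h0 /eqP.
  by rewrite (eq_card0 h0).
pose g H := h H * (xpow k (H :\ l_ H) b * c (l_ H)).
have hS H : #|H| = i.+1 -> S (h H) /\ homog_int (r + (a * i.+2)%N%:Z) (h H).
  move=> Hi; rewrite /h /contraction; case: ifP => pH.
    by split; [exact: is_ideal0 | exact: homog_int0].
  rewrite csignZ; have [|Sf hf] := fS (p |: H).
    by rewrite cardsU1 pH Hi.
  by split; [exact: is_idealZ | exact: homog_intZ].
exists b, g; split.
  move=> H Hi; have [Sh hh] := hS H Hi; split; first exact: is_idealMr.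
  have := homog_intM hh (dhomogM (xpow_homog (H :\ l_ H) b) (cN (l_ H))).
  have : #|H :\ l_ H| = i.
    by have := cardsD1 (l_ H) H; rewrite Hi l_in // => -[].
  by move=> ->; congr homog_int; rewrite /b; lia.
move=> F Fi; exists (K + a)%N.
have -> : (f F * xpow k F b - koszul_d (pow (a + b)) g F) * 'X_p ^+ (K + a) =
    koszul_d (pow (a + b))
      (fun H => h H * xpow k H b * 'X_p ^+ K - g H * 'X_p ^+ (K + a)) F.
  rewrite koszul_dB !koszul_dMr koszul_d_xpow koszul_d_contraction.
  case: ifP => pF; first by rewrite exprD; ring.
  by rewrite fc ?cardsU1 ?pF ?Fi // exprD; ring.
apply: koszul_d_ideal => // l lF.
have Hi : #|F :\ l| = i.+1 by move: Fi; rewrite (cardsD1 l) lF => -[].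
move: (F :\ l) Hi => H Hi.
rewrite (xpowD1 b (l_in H Hi)) /g.
have -> : h H * ('X_(l_ H) ^+ b * xpow k (H :\ l_ H) b) * 'X_p ^+ K -
    h H * (xpow k (H :\ l_ H) b * c (l_ H)) * 'X_p ^+ (K + a) =
    xpow k (H :\ l_ H) b *
      (h H * ('X_(l_ H) ^+ b * 'X_p ^+ K - c (l_ H) * 'X_p ^+ (K + a))) by ring.
apply: is_idealM => //; rewrite /h /contraction; case: ifP => pH.
  by rewrite mul0r; exact: is_ideal0.
rewrite -mulrA; apply: is_idealM => //; apply: cE.
by rewrite cardsU1 pH Hi.
Qed.

End TorsionStep.

End Vanish.

(** * Saturations *)

Section Saturation.
Variables (k : fieldType) (m : nat) (E J : {mpoly k[m]} -> Prop).
Local Notation R := {mpoly k[m]}.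
Local Notation pow a := (fun j : 'I_m => 'X_j ^+ a : {mpoly k[m]}).
Implicit Types (F G H : {set 'I_m}) (f g : {set 'I_m} -> R).
Hypotheses (gE : graded_ideal E).
Let iE := proj1 gE.
Let iS := saturation_ideal J iE.

(** Interpolates between the saturation, for [L = [::]], and its elements that are torsion modulo
    [E] for every variable. *)
Definition torsion_part (L : seq 'I_m) (x : R) :=
  saturation E J x /\ forall p, p \in L -> exists K, E (x * 'X_p ^+ K).

Lemma torsion_part_ideal L : is_ideal (torsion_part L).
Proof.
split.
  split; first exact: is_ideal0 iS.
  by move=> p _; exists 0%N; rewrite mul0r; exact: is_ideal0.
split=> [x y [Sx hx] [Sy hy] | c x [Sx hx]].
  split; first exact: is_idealD.
  move=> p pL; have [K EK] := hx p pL; have [M EM] := hy p pL.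
  exists (K + M)%N; have -> : (x + y) * 'X_p ^+ (K + M) =
    'X_p ^+ M * (x * 'X_p ^+ K) + 'X_p ^+ K * (y * 'X_p ^+ M) by rewrite exprD; ring.
  by apply: is_idealD => //; exact: is_idealM.
split; first exact: is_idealM.
by move=> p pL; have [K EK] := hx p pL; exists K; rewrite -mulrA; exact: is_idealM.
Qed.

Lemma cech_vanishing_saturation_ge2 i r : dim_quot_le1 J ->
  cech_vanishing E i.+2 r -> cech_vanishing (saturation E J) i.+2 r.
Proof.
move=> dJ vE.
(* Raising the level multiplies the component at the nonempty set [F] by [x_F^c], which for large
   [c] carries it into [E]. *)
have {}vE : cech_vanishing (torsion_part (enum 'I_m)) i.+2 r.
  apply: cech_vanishing_step (torsion_part_ideal _) _ _ vE.
    move=> x Ex; split; first exact: saturation_sub.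
    by move=> p _; exists 0%N; exact: is_idealMr.
  move=> a f fS _.
  have /boolp.choice[c cE] : forall F, exists c, #|F| = i.+2 -> E (f F * xpow k F c).
    move=> F; have [Fi|/eqP Fi] := eqVneq #|F| i.+2; last by exists 0%N.
    have [l lF] : exists l, l \in F by apply/card_gt0P; rewrite Fi.
    have [K EK] := proj2 (proj1 (fS F Fi)) l (mem_enum _ l).
    exists K => _; rewrite (xpowD1 _ _ lF) mulrA.
    exact: is_idealMr.
  exists (\sum_F c F)%N, (fun=> 0); split.
    move=> i' _ F _; split; first exact: is_ideal0 (torsion_part_ideal _).
    exact: homog_int0.
  move=> F Fi; rewrite koszul_d0 subr0 -(subnKC (leq_sum_fin F c)) xpowD mulrA.
  by apply: is_idealMr => //; exact: cE.
suff h L : cech_vanishing (torsion_part L) i.+2 r ->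
    cech_vanishing (torsion_part [::]) i.+2 r.
  move=> a f fS fc; have [|c [g [gS gf]]] := h _ vE a f _ fc.
    by move=> F /fS[].
  exists c, g; split => // i' ii' F Fi'.
  by have [[]] := gS i' ii' F Fi'.
(* Variables leave [L] one at a time: [torsion_step] gains torsion for [p], and its correction stays
   in the ideal for [L], so the torsion already present is kept. *)
elim: L => // p L IH vL; apply: IH.
apply: cech_vanishing_step (torsion_part_ideal _) _ _ vL.
  by move=> x [Sx h]; split => // q qL; apply: h; rewrite inE qL orbT.
move=> a f fS fc.
have [|c [g [gS gE']]] := torsion_step p gE dJ (torsion_part_ideal L) _ fS fc.
  by move=> x [].
exists c, g; split; first by move=> _ [<-].
move=> F Fi; have [Sf _] := fS F Fi.
have [S' h'] : torsion_part L (f F * xpow k F c - koszul_d (pow (a + c)) g F).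
  apply: is_idealB (torsion_part_ideal L) _ _.
    exact: is_idealMr (torsion_part_ideal L) _.
  apply: koszul_d_ideal (torsion_part_ideal L) _ => l lF; apply: proj1 (gS _ _).
  by move: Fi; rewrite (cardsD1 l F) lF => -[].
split => // q; rewrite inE => /orP[/eqP->|]; last exact: h'.
exact: gE'.
Qed.

(** If [f] is homogeneous and f q^s is in [E], so is [f]: the component of f q^s in the degree of
    [f] is a nonzero scalar times [f]. Cochains of the saturation thus already lie in [E]. *)
Lemma cech_vanishing_saturation_unit i r :
  (exists2 q, J q & q@_0 != 0) ->
  cech_vanishing E i r -> cech_vanishing (saturation E J) i r.
Proof.
move=> [q Jq q0]; apply: cech_vanishing_step => //.
  by move=> x; exact: saturation_sub.
move=> a f fS _; exists 0%N, (fun=> 0); split.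
  by move=> i' _ F _; split; [exact: is_ideal0 | exact: homog_int0].
move=> F Fi; rewrite koszul_d0 subr0; apply: is_idealMr => //.
have [[s Js] [->|[e [_ fe]]]] := fS F Fi; first exact: is_ideal0.
have := proj2 gE e _ (Js _ (ideal_powX s Jq)).
rewrite mulrC -{1}[e]add0n (projM _ _ fe) proj0 mul_mpolyC rmorphXn.
move/(is_idealZ ((q@_0) ^+ s)^-1 iE).
by rewrite scalerA mulVf ?scale1r // expf_neq0.
Qed.

Lemma irrelevant_ideal_min (B : R -> Prop) : is_ideal B -> (forall j, B 'X_j) ->
  forall x, x@_0 = 0 -> B x.
Proof.
move=> iB BX x x0; rewrite [x]mpolyE; apply: ideal_sum_seq => // w wx.
apply: is_idealZ => //.
have [w0|] := eqVneq w 0%MM.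
  by move: wx; rewrite mcoeff_msupp w0 x0 eqxx.
rewrite -mdeg_eq0 mdegE sum_nat_eq0 negb_forall => /existsP[j /= wj].
have -> : w = (w - U_(j) + U_(j))%MM.
  rewrite submK //; apply/mnm_lepP => l; rewrite mnm1E.
  by case: eqVneq => [<-|_] //=; rewrite lt0n.
by rewrite mpolyXD; apply: is_idealM.
Qed.

(** With mm the irrelevant ideal, x J^(r+1) lies in x mm J^r, and one power J^r carries all the
    products of [x] with the variables into [E]. *)
Lemma saturation_mulX x : (forall y, J y -> y@_0 = 0) ->
  (forall j, saturation E J (x * 'X_j)) -> saturation E J x.
Proof.
move=> Jm /(saturation_uniform (u := fun j => x * 'X_j) iE)[r hr].
exists (1 + r)%N => y; move: y; apply: ideal_pow_min.
  split; first by rewrite mulr0; exact: is_ideal0.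
  split=> [y z hy hz | c y hy]; first by rewrite mulrDr; exact: is_idealD.
  by rewrite mulrCA; exact: is_idealM.
move=> t tJ; rewrite [t]tuple_eta /= big_cons.
apply: (@irrelevant_ideal_min (fun z => E (x * (z * \prod_(v <- behead t) v)))).
- split; first by rewrite mul0r mulr0; exact: is_ideal0.
  split=> [y z hy hz | c y hy]; first by rewrite mulrDl mulrDr; exact: is_idealD.
  by rewrite -mulrA mulrCA; exact: is_idealM.
- move=> j; rewrite mulrA; apply: hr; apply: in_span_sub.
  exists [tuple of behead t]; split => // v /mem_behead; exact: tJ.
- by apply/Jm/tJ; rewrite [t]tuple_eta mem_head.
Qed.

(** A monomial of degree above [m a] is divisible by some x_j^a, hence carries [x] into the
    saturation; [saturation_mulX] then descends degree by degree to the monomial 1. *)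
Lemma saturation_mulXn a x : (forall y, J y -> y@_0 = 0) ->
  (forall j, saturation E J (x * 'X_j ^+ a)) -> saturation E J x.
Proof.
move=> Jm h.
suff main t w : (m * a < mdeg w + t)%N -> saturation E J (x * 'X_[w]).
  have := main (m * a).+1 0%MM; rewrite mdeg0 mpolyX0 mulr1.
  by apply; exact: leqnn.
elim: t w => [|t IH] w le; last first.
  apply: saturation_mulX => // j; rewrite -mulrA -mpolyXD; apply: IH.
  by move: le; rewrite mdegD mdeg1; lia.
have [j aw] : exists j, (a <= w j)%N.
  apply: boolp.contrapT => no; move: le; rewrite addn0 mdegE ltnNge => /negP; apply.
  rewrite -[m in (m * a)%N]card_ord -sum_nat_const; apply: leq_sum => j _.
  by rewrite leqNgt; apply/negP => lt; apply: no; exists j; exact: ltnW.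
have -> : w = (U_(j) *+ a + (w - U_(j) *+ a))%MM.
  rewrite addmC submK //; apply/mnm_lepP => l; rewrite mulmnE mnm1E.
  by case: eqVneq => [<-|_]; rewrite ?mul1n ?mul0n.
by rewrite mpolyXD -mpolyXn mulrA; apply: is_idealMr.
Qed.

(** The cocycle has a primitive over the whole ring. For [i = 1] this is one element whose products
    with the x_j^a are, up to sign, components of the cocycle, so [saturation_mulXn] applies. For
    [i = 0] the primitive has no component to check. *)
Lemma cech_vanishing_saturation_le1 i r : (i < 2)%N ->
  (forall y, J y -> y@_0 = 0) ->
  (forall a f, cochain (fun=> True) i r a f ->
    (forall G, #|G| = i.+1 -> koszul_d (pow a) f G = 0) ->
    exists g, (forall i', i = i'.+1 -> cochain (fun=> True) i' r a g) /\
      forall F, #|F| = i -> f F = koszul_d (pow a) g F) ->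
  cech_vanishing (saturation E J) i r.
Proof.
move=> i2 Jm vR a f fS fc; have [|g [gS gE']] := vR a f _ fc.
  by move=> F /fS[].
exists 0%N, g; rewrite addn0; split; last first.
  by move=> F Fi; rewrite -gE' // /xpow big1 ?mulr1 // => j _; rewrite expr0.
move=> i' ii' F Fi'; have [_ hg] := gS i' ii' F Fi'; split => //.
have i'0 : i' = 0%N by lia.
move: Fi'; rewrite i'0 => /eqP; rewrite cards_eq0 => /eqP->.
apply: (saturation_mulXn (a := a)) => // j.
have j1 : #|[set j]| = i by rewrite cards1 ii' i'0.
have [] := fS _ j1; rewrite gE' // /koszul_d big_set1 setDv -mulrA csignZ.
move=> /(is_idealZ (((-1) ^+ #|[set i0 in [set j] | (i0 < j)%N]|)^-1) iS) + _.
by rewrite scalerA mulVf ?scale1r // signr_eq0.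
Qed.

End Saturation.

(** * Powers of a homogeneous ideal *)

Section Powers.
Variables (k : fieldType) (m : nat) (I : {mpoly k[m]} -> Prop) (s : seq {mpoly k[m]}).
Local Notation R := {mpoly k[m]}.
Local Notation p := (size s).
Local Notation pow a := (fun j : 'I_m => 'X_j ^+ a : {mpoly k[m]}).
Hypotheses (s_homog : forall g, g \in s -> I g /\ is_homogeneous g)
  (s_gen : forall f, I f <-> in_span (fun g => g \in s) f).
Let gen (j : 'I_p) : R := tnth (in_tuple s) j.
Let dg (j : 'I_p) : nat := (msize (gen j)).-1.
Local Notation mon := 'X_{1..(m + p)}.
Implicit Types (w : mon) (P : mon -> Prop) (F G H : {set 'I_m}).

Lemma gen_mem j : gen j \in s.
Proof. exact: mem_tnth. Qed.

Lemma gen_homog j : gen j \is (dg j).-homog.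
Proof. by have [_ [d /dhomog_msize]] := s_homog (gen_mem j). Qed.

Lemma rees_eval_homog w : rees_eval gen w \is (rees_wt dg w).-homog.
Proof.
rewrite /rees_eval /rees_wt; apply: dhomogM.
  elim/big_ind2: _ => [|x a y b xa yb|j _]; first exact: dhomog1.
    exact: dhomogM.
  exact: homogXn.
elim/big_ind2: _ => [|x a y b xa yb|j _]; first exact: dhomog1.
  exact: dhomogM.
exact/dhomogMn/gen_homog.
Qed.

Lemma rees_span_homog d P f :
  (forall w, P w -> (rees_wt dg w)%:Z = d) -> rees_span gen P f -> homog_int d f.
Proof.
move=> Pd h; apply: (rees_span_ind (K := homog_int d) _ _ _ h).
- exact: homog_int0.
- exact: homog_intD.
- move=> c w /Pd wd; apply: homog_intZ; right; exists (rees_wt dg w).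
  by split; [rewrite wd | exact: rees_eval_homog].
Qed.

Lemma rees_span_proj d P f : rees_span gen P f ->
  rees_span gen (fun w => P w /\ rees_wt dg w = d) (pihomog mdeg d f).
Proof.
move=> h; pose Q := fun w => P w /\ rees_wt dg w = d.
apply: (rees_span_ind (K := fun f => rees_span gen Q (pihomog mdeg d f)) _ _ _ h).
- by rewrite pihomog0; exact: rees_span0.
- by move=> x y hx hy; rewrite pihomogD; exact: rees_spanD.
- move=> c w Pw; rewrite linearZ /=; apply: rees_spanZ.
  have hw := rees_eval_homog w.
  have [wd|wd] := eqVneq (rees_wt dg w) d.
    by rewrite pihomog_dE -?wd //; exact: rees_span_eval.
  by rewrite (pihomog_ne0 wd hw); exact: rees_span0.
Qed.

Lemma rees_span_ideal n : is_ideal (rees_span gen (fun w => rees_deg w = n)).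
Proof.
split; first exact: rees_span0.
split=> [x y|r x hx]; first exact: rees_spanD.
rewrite [r]mpolyE mulr_suml; apply: rees_span_sum => u _.
rewrite -scalerAl; apply: rees_spanZ; rewrite mulrC.
pose v : mon := [multinom match split i with inl j => u j | inr _ => 0%N end | i < m + p].
have vl j : v (lshift p j) = u j.
  by rewrite mnmE -[lshift p j]/(unsplit (inl j)) unsplitK.
have vr j : v (rshift m j) = 0%N.
  by rewrite mnmE -[rshift m j]/(unsplit (inr j)) unsplitK.
have -> : 'X_[u] = rees_eval gen v.
  rewrite mpolyXE_id /rees_eval [X in _ * X]big1 => [|j _]; last by rewrite vr expr0.
  by rewrite mulr1; apply: eq_bigr => j _; rewrite vl.
apply: rees_span_shift hx => w <-.
by rewrite rees_degD [X in (_ + X)%N]big1 ?addn0 // => j _; rewrite vr.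
Qed.

Lemma rees_spanM a b (x y : R) :
  rees_span gen (fun w => rees_deg w = a) x ->
  rees_span gen (fun w => rees_deg w = b) y ->
  rees_span gen (fun w => rees_deg w = a + b)%N (x * y).
Proof.
move=> hx [t [tb ->]]; rewrite mulr_sumr big_seq.
apply: rees_span_sum => cw /tb cwb; rewrite -scalerAr; apply: rees_spanZ.
by apply: rees_span_shift hx => w wa; rewrite rees_degD wa cwb.
Qed.

Lemma rees_span_gen x : I x -> rees_span gen (fun w => rees_deg w = 1%N) x.
Proof.
move=> /s_gen; apply: in_span_min; first exact: rees_span_ideal.
move=> g gs; have gi : (index g s < p)%N by rewrite index_mem.
pose j : 'I_p := Ordinal gi.
have gj : gen j = g by rewrite /gen (tnth_nth 0) /= nth_index.
have -> : g = rees_eval gen U_(rshift m j).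
  rewrite /rees_eval big1 => [|l _]; last by rewrite mnm1E eq_rlshift expr0.
  rewrite mul1r (bigD1 j) //= big1 => [|l /negPf lj].
    by rewrite mnm1E eqxx expr1 mulr1.
  by rewrite mnm1E eq_rshift eq_sym lj expr0.
apply: rees_span_eval; rewrite /rees_deg (bigD1 j) //= big1 => [|l /negPf lj].
  by rewrite mnm1E eqxx.
by rewrite mnm1E eq_rshift eq_sym lj.
Qed.

Lemma ideal_pow_rees n x :
  ideal_pow I n x <-> rees_span gen (fun w => rees_deg w = n) x.
Proof.
split.
  move: x; apply: ideal_pow_min; first exact: rees_span_ideal.
  suff h (u : seq R) : (forall x, x \in u -> I x) ->
      rees_span gen (fun w => rees_deg w = size u) (\prod_(x <- u) x).
    by move=> t /h; rewrite size_tuple.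
  elim: u => [|x u IH] uI /=.
    have e1 : rees_eval gen 0%MM = 1.
      by rewrite /rees_eval !big1 ?mulr1 // => j _; rewrite mnm0E expr0.
    rewrite big_nil -e1; apply: rees_span_eval.
    by rewrite /rees_deg big1 // => j _; rewrite mnm0E.
  rewrite big_cons -add1n; apply: rees_spanM.
    by apply/rees_span_gen/uI; rewrite mem_head.
  by apply: IH => z zu; apply: uI; rewrite inE zu orbT.
have iI := ideal_pow_ideal I n.
move=> h; apply: (rees_span_ind (K := ideal_pow I n) _ _ _ h) => {x h}.
- exact: is_ideal0.
- by move=> x y; exact: is_idealD.
- move=> c w <-; apply: is_idealZ; first exact: ideal_pow_ideal.
  apply: is_idealM; first exact: ideal_pow_ideal.
  rewrite /rees_deg; elim/big_ind2: _ => [|x a y b|j _]; first exact: ideal_pow0.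
    exact: ideal_powM.
  by apply/ideal_powX/(proj1 (s_homog (gen_mem j))).
Qed.

Lemma ideal_pow_graded n : graded_ideal (ideal_pow I n).
Proof.
split=> [|d f]; first exact: ideal_pow_ideal.
rewrite !ideal_pow_rees => /(rees_span_proj d).
by apply: rees_span_sub => w [].
Qed.

(** [N] is fixed before [n], and [n = 0] covers the whole ring I^0. Exactness holds at each level
    [a], before passing to the limit. *)
Lemma ideal_pow_koszul_exact : exists N : nat,
  forall (D n i : nat) (r : int), (forall j, dg j <= D)%N ->
    (D * n + m * N)%N%:Z < r -> forall a f, cochain (ideal_pow I n) i r a f ->
  (forall G, #|G| = i.+1 -> koszul_d (pow a) f G = 0) ->
  exists g, (forall i', i = i'.+1 -> cochain (ideal_pow I n) i' r a g) /\
    forall F, #|F| = i -> f F = koszul_d (pow a) g F.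
Proof.
have [N Nspec] := koszul_vanishing gen dg; exists N => D n i r dgD rbig a f fI fc.
have [|g [gspan gE]] := Nspec D n a i r f dgD rbig _ fc.
  move=> F Fi; have [/ideal_pow_rees If [->|[d [-> fd]]]] := fI F Fi.
    exact: rees_span0.
  rewrite -(pihomog_dE fd); apply: rees_span_sub (rees_span_proj d If) => w.
  by case=> -> ->.
exists g; split => // i' ii' H Hi'; have gH := gspan H; rewrite Hi' in gH.
have {}gH := gH (esym ii'); split.
  by apply/ideal_pow_rees; apply: rees_span_sub gH => w [].
by apply: rees_span_homog gH => w [].
Qed.

End Powers.

(** * The regularity bound *)

Unset Implicit Arguments.

Theorem theorem2p3 (k : fieldType) (m : nat) (I J : {mpoly k[m]} -> Prop) (D : nat) :
  is_ideal I -> homogeneous_ideal I -> is_ideal J -> dim_quot_le1 J ->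
  max_gen_degree I D ->
  exists e : int, forall n : nat, (0 < n)%N ->
    reg_le (symb_pow I J n) ((D * n)%N%:Z + e).
Proof.
move=> _ _ _ dJ [s [s_homog s_gen _ DE]].
have [N Nspec] := ideal_pow_koszul_exact s_homog s_gen.
have dgD (j : 'I_(size s)) : ((msize (tnth (in_tuple s) j)).-1 <= D)%N.
  rewrite DE; apply: (leq_bigmax_seq (F := fun g => (msize g).-1)) => //.
  exact: mem_tnth.
(* Vanishing holds for [r > D n + m N]; replacing [r] by [r + i] with [i <= m] costs the further
   [m]. *)
exists (m * N + m)%N%:Z => n _ i r [a [f [fc nfb]]].
rewrite leNgt; apply/negP => rbig; apply: nfb.
have iS := saturation_ideal J (ideal_pow_ideal I n).
(* Above [m] there are no index sets of size [i], so every cochain is a coboundary. *)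
have [lt_im|le_im] := ltnP m i.
  case: i lt_im {rbig fc} => [//|i] lt_im.
  exists 0%N, (fun=> 0); split; first by move=> H _; split; [exact: is_ideal0 | left].
  by move=> F Fi; have := max_card (mem F); rewrite Fi card_ord leqNgt lt_im.
have {}rbig : (D * n + m * N)%N%:Z < r by lia.
apply: cech_vanishing_coboundary fc; rewrite -[symb_pow _ _ _]/(saturation _ _).
have gE := ideal_pow_graded s_homog s_gen n.
have vE : cech_vanishing (ideal_pow I n) i r.
  move=> b g gS gc; have [h [hS hE]] := Nspec D n i r dgD rbig b g gS gc.
  exists 0%N, h; rewrite addn0; split => // F Fi.
  by rewrite -hE // /xpow big1 ?mulr1 // => j _; rewrite expr0.
have [qJ|noq] := boolp.EM (exists2 q, J q & q@_0 != 0).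
  exact: cech_vanishing_saturation_unit.
have Jm y : J y -> y@_0 = 0.
  by move=> Jy; apply/eqP; apply: boolp.contrapT => /negP y0; apply: noq; exists y.
case: i le_im rbig vE => [|[|i]] le_im rbig vE; last first.
  exact: cech_vanishing_saturation_ge2.
all: apply: cech_vanishing_saturation_le1 => // b g gS gc.
(* Degrees 0 and 1 use exactness for R = I^0, whose threshold [m N] is at most that of I^n. *)
all: have r0 : (D * 0 + m * N)%N%:Z < r by lia.
all: have [|h [hS hE]] := Nspec D 0%N _ r dgD r0 b g _ gc.
all: try by move=> F /gS[_ ?]; split => //; exact: ideal_pow0.
all: exists h; split => // i' ii' H /(hS i' ii')[_ ?]; by split.
Qed.
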